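(* $R_3(P_7) = 13$ and $R_3(P_9) = 17$.
   Context: All graphs are undirected, finite, with no loops or multiple edges. $P_k$ denotes the path on $k$ vertices, and $K_N$ denotes the complete graph on $N$ vertices. For a graph $G$, the three-color diagonal Ramsey number $R_3(G) = R(G,G,G)$ is the smallest integer $N$ such that every coloring of the edges of $K_N$ with 3 colors contains a monochromatic copy of $G$ (as a not necessarily induced subgraph), i.e. there is a color $i \in \{1,2,3\}$ such that the graph formed by the edges of color $i$ contains a subgraph isomorphic to $G$. *)

(* Defs.v *)
From mathcomp Require Import all_boot.

Set Implicit Arguments.
Unset Strict Implicit.
Unset Printing Implicit Defensive.

Record sgraph := SGraph {
  vertex :> finType;
  adj : rel vertex;
  adj_sym : symmetric adj;
  adj_irrefl : irreflexive adj }.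

Section PathGraph.
Variable k : nat.

Definition path_adj : rel 'I_k :=
  fun x y => (x.+1 == y :> nat) || (y.+1 == x :> nat).

Lemma path_adj_sym : symmetric path_adj.
Proof. by move=> x y; rewrite /path_adj orbC. Qed.

Lemma path_adj_irrefl : irreflexive path_adj.
Proof. by move=> x; rewrite /path_adj orbb eqn_leq ltnn. Qed.

(* Indexed by the number of vertices, not of edges. *)
Definition path_graph : sgraph := SGraph path_adj_sym path_adj_irrefl.

End PathGraph.

Section CompleteGraph.
Variable N : nat.

Definition complete_adj : rel 'I_N := fun x y => x != y.

Lemma complete_adj_sym : symmetric complete_adj.
Proof. by move=> x y; rewrite /complete_adj eq_sym. Qed.

Lemma complete_adj_irrefl : irreflexive complete_adj.
Proof. by move=> x; rewrite /complete_adj eqxx. Qed.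

Definition complete_graph : sgraph :=
  SGraph complete_adj_sym complete_adj_irrefl.

End CompleteGraph.

(* An edge is the unordered pair [set x; y] of its ends; the values of a
   colouring on sets that are not edges of H are never used. *)
Definition edge_colouring (H : sgraph) (r : nat) := {set H} -> 'I_r.

Section ColourClass.
Variables (H : sgraph) (r : nat) (c : edge_colouring H r) (i : 'I_r).

Definition colour_adj : rel H := fun x y => adj x y && (c [set x; y] == i).

Lemma colour_adj_sym : symmetric colour_adj.
Proof. by move=> x y; rewrite /colour_adj adj_sym setUC. Qed.

Lemma colour_adj_irrefl : irreflexive colour_adj.
Proof. by move=> x; rewrite /colour_adj adj_irrefl. Qed.

Definition colour_class : sgraph := SGraph colour_adj_sym colour_adj_irrefl.

End ColourClass.

(* H has a (not necessarily induced) subgraph isomorphic to G. *)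
Definition contains_copy (H G : sgraph) : Prop :=
  exists2 f : G -> H, injective f & forall x y : G, adj x y -> adj (f x) (f y).

Definition ramsey3_prop (G : sgraph) (N : nat) : Prop :=
  forall c : edge_colouring (complete_graph N) 3,
    exists i : 'I_3, contains_copy (colour_class c i) G.

(* The relation "R_3(G) = N", N being the least number with the property. *)
Definition is_ramsey3 (G : sgraph) (N : nat) : Prop :=
  ramsey3_prop G N /\ forall M : nat, ramsey3_prop G M -> N <= M.

(* Main.v *)
(* The two upper bounds share one argument, with m = 3 and m = 4: a P_{2m+1}-free
   colour class on 4m + 1 vertices must be sparse.  Let G be the densest class.

   If some union A of components of G has 2m - 1 to 2m + 2 vertices, then the
   other two colours cover the complete bipartite graph between A and its
   complement, and one of them has too many edges: the ends of a longest path in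
   a bipartite graph without P_{2m+1} have low degree, unless the path closes
   into a cycle spanning its component.

   Otherwise G is essentially one component.  The ends of a longest path can be
   deleted one at a time, without disconnecting the component and at a cost of at
   most m - 1 edges each, down to 2m + 1 vertices without a Hamiltonian path, where
   Chvatal's degree condition applies.  For m = 3 this leaves too few edges.  For
   m = 4 only K_3 joined to a graph with a single edge survives; then the other
   two colours cover all but one edge of a K_14, which is again too many.

   For the lower bounds, the 4m vertices are split into four classes of m, and
   each colour lives on two disjoint unions of two classes. *)
Require Import Defs.
From mathcomp Require Import all_boot zify.

Set Implicit Arguments.
Unset Strict Implicit.
Unset Printing Implicit Defensive.

(** * Walks and counting along sequences *)

(** The window from 2m - 1 to 2m + 2 suits the argument twice over: on 4m + 1 vertices it is stable
    under complement, and its lower end is always reached. Indeed the densest class has average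
    degree above 3 (m = 3) or above 5 (m = 4), so some vertex has degree at least 2m - 2 and its
    component at least 2m - 1 vertices. A component above the window has at least 2m + 3 vertices,
    so deletion down to 2m + 1 applies to it. The bipartite bound is proved by an induction whose
    numerical inequalities are checked by evaluation over finite ranges of part sizes. The tight
    case is m = 4. Since 17 * 16 = 272 exceeds 3 * 90, some class has doubled edge count at least
    91, hence 92 by parity, while deletion alone only gives at most 94 for a connected class. The
    graph that survives has doubled count 6n - 10, exactly 92 for n = 17. Counting therefore cannot
    exclude it, and its structure has to be carried through the deletion. *)

Section Walks.
Variables (T : eqType) (e : rel T).
Hypothesis e_sym : symmetric e.

(** Both ends are named, so that rearranged pieces of a path can be glued end to end; the empty
    sequence is not a walk. *)
Definition walk x s y :=
  if s is a :: s' then [&& a == x, path e a s' & last a s' == y] else false.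

Lemma walk_sorted x s y : walk x s y -> sorted e s.
Proof. by case: s => //= a s /and3P[]. Qed.

Lemma sorted_walk a s : sorted e (a :: s) -> walk a (a :: s) (last a s).
Proof. by move=> /= ->; rewrite !eqxx. Qed.

Lemma walk_cat x s y z t w :
  walk x s y -> walk z t w -> e y z -> walk x (s ++ t) w.
Proof.
case: s => // a s /and3P[/eqP<- ps /eqP<-].
case: t => // b t /and3P[/eqP<- pt /eqP<-] eab /=.
by rewrite eqxx cat_path ps last_cat /= eab pt eqxx.
Qed.

Lemma walk1 x : walk x [:: x] x.
Proof. by rewrite /= !eqxx. Qed.

Lemma walk_cons x y s z : e x y -> walk y s z -> walk x (x :: s) z.
Proof. by move=> exy ws; apply: (walk_cat (walk1 x) ws). Qed.

Lemma walk_rcons x s y z : walk x s y -> e y z -> walk x (rcons s z) z.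
Proof. by move=> ws eyz; rewrite -cats1; apply: (walk_cat ws (walk1 z)). Qed.

Lemma walk_split x s a b t y :
  walk x (rcons s a ++ b :: t) y ->
  [/\ walk x (rcons s a) a, walk b (b :: t) y & e a b].
Proof.
case: s => [|c s] /=; rewrite ?cat_path ?rcons_path ?last_cat /=.
  by case/and3P=> /eqP-> /andP[-> ->] ->; rewrite !eqxx.
case/and3P=> -> /andP[/andP[-> ->]] /=; rewrite last_rcons => /andP[-> ->] ->.
by rewrite !eqxx.
Qed.

Lemma walk_rev x s y : walk x s y -> walk y (rev s) x.
Proof.
elim: s x => // a s IHs x; case: s IHs => [|b s] IHs.
  by move=> /= /andP[/eqP<- /eqP<-]; rewrite !eqxx.
rewrite [walk _ _ _]/= => /and3P[/eqP<- /andP[eab ps] /eqP ls].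
rewrite rev_cons; apply: (@walk_rcons _ _ b); last by rewrite e_sym.
by apply: IHs; rewrite /= ps ls !eqxx.
Qed.

Lemma walk_cycle x s y : walk x s y -> e y x -> cycle e s.
Proof.
by case: s => //= a s /and3P[/eqP<- ps /eqP<-] eya; rewrite rcons_path ps.
Qed.

Lemma cycle_walk c x : cycle e c -> x \in c ->
  exists i s, [/\ rot i c = x :: s, path e x s & e (last x s) x].
Proof.
move=> cc xc; have [i s def_c] := rot_to xc; exists i, s.
by move: cc; rewrite -(rot_cycle i) def_c /= rcons_path => /andP[].
Qed.

End Walks.

Lemma not_sorted_split (T : Type) (r : rel T) s : ~~ sorted r s ->
  exists s1 x y s2, s = rcons s1 x ++ y :: s2 /\ ~~ r x y.
Proof.
elim: s => // x [|y s] //= IHs; case exy: (r x y) => //=.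
  case/IHs=> s1 [a [b [s2 [-> nab]]]].
  by exists (x :: s1), a, b, s2.
by move=> _; exists [::], x, y, s; rewrite exy.
Qed.

(* If a and b never hold at consecutive positions of s, in this order, then
   sending each position of b to its predecessor makes it disjoint from a. *)
Lemma count_shift (T : Type) (a b : pred T) x s :
  path (fun y z => ~~ (a y && b z)) x s ->
  count a (x :: s) + count b s <= size s + a (last x s).
Proof.
elim: s x => [|y s IHs] x /=; first by rewrite !addn0.
case/andP=> nab /IHs le_s; have le1 : a x + b y <= 1.
  by move: nab; case: (a x) (b y) => [] [].
by have := leq_add le1 le_s; rewrite addnACA add1n addSn addnA.
Qed.

Lemma count_shift_lt (T : Type) (a b : pred T) x s :
  path (fun y z => ~~ (a y && b z)) x s -> ~~ a (last x s) -> ~~ b x ->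
  count a (x :: s) + count b (x :: s) <= size s.
Proof.
move=> srt /negbTE na /negbTE nb; have := count_shift srt.
by rewrite na [count b (x :: s)]/= nb addn0 add0n.
Qed.

(* On a sequence alternating between c and ~~ c, only every second pair of
   consecutive positions counts. *)
Lemma count_shift_alt (T : Type) (side : pred T) c (a b : pred T) n x s :
    size s = n.*2.+1 ->
    path (fun y z => ~~ (a y && b z)) x s ->
    path (fun y z => side y != side z) x s ->
    (forall y, a y -> side y = c) -> (forall y, b y -> side y = ~~ c) ->
    side x = c ->
  count a (x :: s) + count b (x :: s) <= n.+1.
Proof.
move=> + + + sa sb; elim: n x s => [|n IHn] x [|y s] //= [sz].
all: case/andP=> nab ss /andP[sxy alt] sx.
all: have sy : side y = ~~ c by move: sxy; rewrite sx; case: (side y) (c) => [] [].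
all: have ay : a y = false by apply/negP=> /sa; rewrite sy; case: (c).
all: have bx : b x = false by apply/negP=> /sb; rewrite sx; case: (c).
  by case: s sz {ss alt} nab => //= _; rewrite ay bx; case: (a x) (b y) => [] [].
case: s sz ss alt => // z s [sz] /andP[_ ss] /andP[syz alt].
have sz' : side z = c by move: syz; rewrite sy; case: (side z) (c) => [] [].
have := IHn z s sz ss alt sz'; move: nab; rewrite ay bx /=.
by case: (a x) (b y) => [] [] //=; lia.
Qed.

Lemma count_alt (T : Type) (side : pred T) c x s :
  path (fun y z => side y != side z) x s -> side x = c ->
  count (fun y => side y == ~~ c) (x :: s) = (size s).+1./2.
Proof.
elim: s x c => [|y s IHs] x c /=; first by move=> _ ->; case: c.
case/andP=> sxy alt sx; have sy : side y = ~~ c.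
  by move: sxy; rewrite sx; case: (side y) (c) => [] [].
have := count_predC (fun y => side y == ~~ c) (y :: s).
have := IHs y _ alt sy; rewrite /= sy sx negbK eqxx.
have -> : (~~ c == c) = false by case: c {sx sy}.
have -> : (c == ~~ c) = false by case: c {sx sy}.
rewrite (eq_count (a2 := predC (fun y => side y == ~~ c))); last first.
  by move=> z /=; case: (side z) (c) => [] [].
by move=> -> /=; lia.
Qed.

(** * Degrees, components and longest paths in finite graphs *)

Section Graphs.
Variables (T : finType) (e : rel T).
Implicit Types (S A B C : {set T}) (x y z : T) (p : seq T).

Definition deg S x := #|[set y in S | e x y]|.

(** Twice the number of edges inside [S]. *)
Definition vol S := \sum_(x in S) deg S x.

Definition ipath S p := [&& uniq p, sorted e p & all [in S] p].

(** [L] counts vertices: the bound [m.*2] used throughout means that there is no path on 2m + 1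
    vertices. *)
Definition paths_le S L := forall p, ipath S p -> size p <= L.

Definition closed_in S A :=
  (A \subset S) && [forall x in A, forall y in S, e x y ==> (y \in A)].

(** Connectivity phrased through unions of components ([closed_in]) rather than walks, so that
    components arise as minimal closed sets. *)
Definition conn S := forall A, closed_in S A -> A != set0 -> A = S.

Hypotheses (e_sym : symmetric e) (e_irr : irreflexive e).

Lemma degE S x : deg S x = \sum_(y in S) e x y.
Proof.
rewrite /deg -sum1_card (eq_bigl (fun y => (y \in S) && e x y)).
  by rewrite big_mkcondr; apply: eq_bigr => y _; case: (e x y).
by move=> y; rewrite inE.
Qed.

Lemma deg_setD S A x : A \subset S -> deg S x = deg A x + deg (S :\: A) x.
Proof.
by move=> sAS; rewrite !degE (big_setID A) /= (setIidPr sAS).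
Qed.

Lemma deg_subset S A x : A \subset S -> deg A x <= deg S x.
Proof. by move=> sAS; rewrite (deg_setD x sAS) leq_addr. Qed.

Lemma deg_lt_card S x : x \in S -> deg S x < #|S|.
Proof.
move=> xS; rewrite (cardsD1 x S) xS add1n ltnS; apply/subset_leq_card/subsetP=> y.
by rewrite !inE => /andP[-> exy]; case: eqP exy => // ->; rewrite e_irr.
Qed.

Lemma sum_deg_sym A B : \sum_(x in A) deg B x = \sum_(x in B) deg A x.
Proof.
under eq_bigr do rewrite degE; rewrite exchange_big /=.
by apply: eq_bigr => x _; rewrite degE; apply: eq_bigr => y _; rewrite e_sym.
Qed.

Lemma vol_setD S A : A \subset S ->
  vol S = vol A + vol (S :\: A) + 2 * \sum_(x in A) deg (S :\: A) x.
Proof.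
move=> sAS; rewrite /vol (big_setID A) /= (setIidPr sAS).
rewrite (eq_bigr _ (fun x _ => deg_setD x sAS)) big_split /=.
rewrite [X in _ + X](eq_bigr _ (fun x _ => deg_setD x sAS)) big_split /=.
by rewrite (sum_deg_sym (S :\: A) A); lia.
Qed.

(** The degree sum over [A] counts the edges inside [A] twice and those leaving [A] once; [vol A]
    stands on the left to avoid subtraction. *)
Lemma vol_sum_deg S A : A \subset S ->
  vol S + vol A = vol (S :\: A) + 2 * \sum_(x in A) deg S x.
Proof.
move=> sAS; rewrite (vol_setD sAS).
by rewrite (eq_bigr _ (fun x _ => deg_setD x sAS)) big_split /= /vol; lia.
Qed.

Lemma vol_setD1 S x : x \in S -> vol S = vol (S :\ x) + 2 * deg S x.
Proof.
move=> xS; have := @vol_sum_deg S [set x]; rewrite sub1set => /(_ xS).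
by rewrite /vol !big_set1 degE big_set1 e_irr addn0.
Qed.

(** Deleting a vertex lowers [vol] by twice its degree. For 17 vertices this parity raises 91 to
    92. *)
Lemma vol_even S : ~~ odd (vol S).
Proof.
have [n] := ubnP #|S|; elim: n S => // n IHn S lt_S.
have [->|[x xS]] := set_0Vmem S; first by rewrite /vol big_set0.
rewrite (vol_setD1 xS) oddD oddM addbF IHn //.
by move: lt_S; rewrite (cardsD1 x S) xS.
Qed.

Lemma vol_deg_le S d : (forall x, x \in S -> deg S x <= d) -> vol S <= #|S| * d.
Proof. by move=> le_d; rewrite -sum_nat_const; apply: leq_sum. Qed.

Lemma vol_le_card S : vol S <= #|S| * #|S|.-1.
Proof. by apply: vol_deg_le => x xS; have := deg_lt_card xS; lia. Qed.

Lemma closed_inP S A :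
  reflect (A \subset S /\ forall x y, x \in A -> y \in S -> e x y -> y \in A)
          (closed_in S A).
Proof.
apply: (iffP andP) => [[sAS clA]|[sAS clA]]; split=> //.
  by move=> x y xA yS exy; apply: (implyP (forall_inP (forall_inP clA x xA) y yS)).
by apply/forall_inP=> x xA; apply/forall_inP=> y yS; apply/implyP; apply: clA.
Qed.

Lemma closed_inD S A : closed_in S A -> closed_in S (S :\: A).
Proof.
case/closed_inP=> sAS clA; apply/closed_inP; split=> [|x y]; first exact: subsetDl.
case/setDP=> xS xA yS exy; rewrite inE yS andbT.
by apply: contra xA => yA; apply: (clA y) => //; rewrite e_sym.
Qed.

Lemma vol_closed S A : closed_in S A -> vol S = vol A + vol (S :\: A).
Proof.
case/closed_inP=> sAS clA; rewrite (vol_setD sAS) big1 ?muln0 ?addn0 // => x xA.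
rewrite degE big1 // => y /setDP[yS yA].
by case exy: (e x y) => //; rewrite (clA x y) in yA.
Qed.

(** A closed set of least cardinality through [x] is connected: of a closed part and its relative
    complement, the one containing [x] would otherwise be a smaller choice. *)
Lemma component S x : x \in S ->
  exists C, [/\ closed_in S C, conn C & x \in C].
Proof.
move=> xS; pose P C := closed_in S C && (x \in C).
have PS : P S by rewrite /P xS andbT; apply/closed_inP; split.
have [C /andP[clC xC] minC] := arg_minnP (fun C => #|C|) PS.
exists C; split=> // A clA A0.
have [sCS clC'] := closed_inP _ _ clC.
have tr B : closed_in C B -> closed_in S B.
  case/closed_inP=> sBC clB; apply/closed_inP; split.
    exact: subset_trans sBC sCS.
  move=> y z yB zS eyz; apply: (clB y) => //.
  exact: clC' (subsetP sBC _ yB) zS eyz.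
have minC' B : closed_in C B -> x \in B -> B = C.
  move=> clB xB; have [sBC _] := closed_inP _ _ clB.
  by apply/eqP; rewrite eqEcard sBC minC // /P tr.
have [xA|xA] := boolP (x \in A); first exact: minC'.
have CDA : C :\: A = C by apply: minC'; rewrite ?closed_inD // inE xA.
have [sAC _] := closed_inP _ _ clA.
by case/set0Pn: A0 => y yA; have := subsetP sAC y yA; rewrite -CDA inE yA.
Qed.

Lemma deg_component S C x : closed_in S C -> x \in C -> deg S x = deg C x.
Proof.
case/closed_inP=> sCS clC xC; apply: eq_card => y; rewrite !inE.
apply: andb_id2r => exy; apply/idP/idP=> [yS|/(subsetP sCS)//].
exact: clC exy.
Qed.

(** The component of a vertex of degree at least [t] contains that vertex and all its neighbours. *)
Lemma big_component_or_deg S t :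
  (exists C, [/\ closed_in S C, conn C & t < #|C|]) \/
  (forall x, x \in S -> deg S x < t).
Proof.
have [/exists_inP[x xS degx]|nex] := boolP [exists x in S, t <= deg S x].
  left; have [C [clC cnC xC]] := component xS; exists C; split=> //.
  by apply: leq_ltn_trans degx _; rewrite (deg_component clC xC) deg_lt_card.
right=> x xS; rewrite ltnNge; apply: contra nex => degx.
by apply/exists_inP; exists x.
Qed.

Lemma ipath_subset S A p : A \subset S -> ipath A p -> ipath S p.
Proof.
move=> sAS /and3P[up ep /allP Ap]; apply/and3P; split=> //.
by apply/allP=> x /Ap /(subsetP sAS).
Qed.

Lemma paths_le_subset S A L : A \subset S -> paths_le S L -> paths_le A L.
Proof. by move=> sAS leS p /(ipath_subset sAS) /leS. Qed.

Lemma ipath_rev S p : ipath S (rev p) = ipath S p.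
Proof.
rewrite /ipath rev_uniq all_rev rev_sorted; congr [&& _, _ & _].
by case: p => //= x p; apply: eq_path => y z; rewrite e_sym.
Qed.

Lemma ipath_leq_card S p : ipath S p -> size p <= #|S|.
Proof.
case/and3P=> up _ /allP Sp; rewrite -(card_uniqP up).
by apply/subset_leq_card/subsetP.
Qed.

Lemma longest_path S x : x \in S ->
  exists y p, ipath S (y :: p) /\ forall q, ipath S q -> size q <= (size p).+1.
Proof.
move=> xS; pose P n := [exists p : n.-tuple T, ipath S p].
have P1 : P 1 by apply/existsP; exists [tuple x]; rewrite /ipath /= xS.
have Pub n : P n -> n <= #|S|.
  by case/existsP=> p /ipath_leq_card; rewrite size_tuple.
have [n /existsP[p pP] maxn] := ex_maxnP (ex_intro P 1 P1) Pub.
have n_gt0 : 0 < n by apply: maxn.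
have sp := size_tuple p; case def_p: (tval p) pP sp => [|y q] pP /= sp.
  by rewrite -sp in n_gt0.
exists y, q; split=> // r rP; rewrite sp; apply: maxn.
by apply/existsP; exists (in_tuple r).
Qed.

Definition longest S p := ipath S p /\ forall q, ipath S q -> size q <= size p.

Lemma longest_rev S p : longest S p -> longest S (rev p).
Proof. by case=> pP maxp; split=> [|q /maxp]; rewrite ?ipath_rev ?size_rev. Qed.

Lemma longest_nbr S x p y : longest S (x :: p) -> y \in S -> e x y -> y \in p.
Proof.
case=> /and3P[up ep Sp] maxp yS exy; apply/negPn/negP=> yp.
have /maxp : ipath S (y :: x :: p); last by rewrite /= ltnn.
rewrite /ipath /= yS (e_sym y) exy (ep : path e x p) (Sp : _ && _) inE.
rewrite (negbTE yp) orbF !andbT (up : _ && _) andbT.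
by apply: contraTneq exy => ->; rewrite e_irr.
Qed.

Lemma deg_count S x p : uniq p -> {subset p <= S} ->
  (forall y, y \in S -> e x y -> y \in p) -> deg S x = count (e x) p.
Proof.
move=> up Sp nbr; rewrite -size_filter -(card_uniqP (filter_uniq _ up)).
apply: eq_card => y; rewrite !inE mem_filter andbC; apply: andb_id2l => exy.
by apply/idP/idP=> [/nbr->|/Sp].
Qed.

Lemma deg_longest S x p : longest S (x :: p) -> deg S x = count (e x) (x :: p).
Proof.
move=> lp; have [/and3P[up _ /allP Sp] _] := lp; apply: deg_count => // y yS exy.
by rewrite inE (longest_nbr lp yS exy) orbT.
Qed.

Lemma deg_longest_last S x p :
  longest S (x :: p) -> deg S (last x p) = count (e (last x p)) (x :: p).
Proof.
move/longest_rev; rewrite lastI rev_rcons => /deg_longest->.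
by rewrite -rev_rcons count_rev.
Qed.

(* Rotating the crossing edges of a path gives a cycle on its vertices. *)
Lemma crossing_cycle S x p : ipath S (x :: p) ->
    ~~ path (fun y z => ~~ (e (last x p) y && e x z)) x p ->
  exists c, [/\ cycle e c, uniq c & perm_eq c (x :: p)].
Proof.
case/and3P=> up ep _ ns.
have [s1 [y [z [s2 [def_p]]]]] := @not_sorted_split _ _ (x :: p) ns.
rewrite negbK => /andP[ely exz].
have w := sorted_walk ep; rewrite def_p in w.
have [w1 w2 _] := walk_split w.
exists (rcons s1 y ++ rev (z :: s2)).
have pc : perm_eq (rcons s1 y ++ rev (z :: s2)) (x :: p).
  by rewrite def_p perm_cat2l perm_rev.
split=> //; last by rewrite (perm_uniq pc).
apply: (walk_cycle (x := x) (y := z)); last by rewrite e_sym.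
by apply: (walk_cat w1 (walk_rev e_sym w2)); rewrite e_sym.
Qed.

Lemma ipath_cycle_cons S c x w : cycle e c -> uniq c -> {subset c <= S} ->
  x \in c -> w \in S -> w \notin c -> e w x ->
  exists2 q, ipath S (w :: q) & perm_eq q c.
Proof.
move=> cc uc Sc xc wS wc ewx; have [i [s [def_c ps _]]] := cycle_walk cc xc.
have pc : perm_eq (x :: s) c by rewrite -def_c perm_rot.
have Sxs : all [in S] (x :: s).
  by apply/allP=> y ys; apply: Sc; rewrite -(perm_mem pc).
exists (x :: s) => //; apply/and3P; split=> /=; last 1 first.
- by rewrite wS.
- by rewrite -[_ && uniq s]/(uniq (x :: s)) (perm_uniq pc) uc (perm_mem pc) wc.
by rewrite ewx ps.
Qed.

(** An edge leaving the cycle would let it be opened into a path with one vertex more than the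
    cycle, hence longer than [L]. *)
Lemma conn_cycle S L c : conn S -> paths_le S L -> cycle e c -> uniq c ->
  {subset c <= S} -> L <= size c -> c != [::] -> S =i c.
Proof.
move=> cnS leL cc uc Sc leLc c0.
have sc : [set x in c] \subset S by apply/subsetP=> x; rewrite inE => /Sc.
suff : [set x in c] = S by move=> <- x; rewrite inE.
apply: cnS; last by case: (c) c0 => // a s _; apply/set0Pn; exists a; rewrite !inE eqxx.
apply/closed_inP; split=> // x y; rewrite !inE => xc yS exy; apply/negPn/negP=> yc.
rewrite e_sym in exy.
have [q /leL + /perm_size eq_sz] := ipath_cycle_cons cc uc Sc xc yS yc exy.
by rewrite /= eq_sz ltnNge leLc.
Qed.

(* The ends of a longest path see only the path, which stays connected. *)
Lemma conn_setD1_end S x p : conn S -> longest S (x :: p) -> conn (S :\ x).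
Proof.
move=> cnS lp; have [ip _] := lp; have /and3P[/andP[xp _] ep /andP[xS Sp]] := ip.
have nbrx y : y \in S -> e x y -> y \in p := longest_nbr lp.
(* All neighbours of [x] lie on [p], so such an [A] is closed in [S] as well; as it misses [x],
   connectivity leaves only the empty set. *)
have half A : closed_in (S :\ x) A -> {in p, forall y, y \notin A} -> A = set0.
  case/closed_inP=> sA clA pA; apply/eqP/negPn/negP=> A0.
  have xA : x \notin A by apply/negP=> /(subsetP sA); rewrite !inE eqxx.
  suff AS : A = S by rewrite AS xS in xA.
  apply: cnS => //; apply/closed_inP; split=> [|y z yA zS eyz].
    exact: subset_trans sA (subsetDl _ _).
  have [zx|zx] := eqVneq z x.
    rewrite zx e_sym in eyz; have := subsetP sA y yA; rewrite !inE => /andP[_ yS].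
    by have := pA y (nbrx y yS eyz); rewrite yA.
  by apply: (clA y) => //; rewrite !inE zx.
have allp A : closed_in (S :\ x) A ->
    {in p, forall y, y \in A} \/ {in p, forall y, y \notin A}.
  move=> clA; have [sA clA'] := closed_inP _ _ clA.
  have clB := closed_inD clA; have [_ clB'] := closed_inP _ _ clB.
  have Sxp : {subset p <= S :\ x}.
    move=> y yp; rewrite !inE (allP Sp _ yp) andbT.
    by apply: contraNneq xp => <-.
  have prop B y q : closed_in (S :\ x) B -> path e y q -> y \in B ->
      {subset q <= S :\ x} -> {subset q <= B}.
    case/closed_inP=> _ clB2; elim: q y => // z q IHq y /= /andP[eyz pq] yB sq.
    have zB : z \in B by apply: (clB2 y) => //; apply: sq; rewrite inE eqxx.
    move=> t; rewrite inE => /predU1P[->//|]; apply: IHq pq zB _ _.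
    by move=> u uq; apply: sq; rewrite inE uq orbT.
  case: (p) ep Sxp => [|y q]; first by left.
  case/andP=> _ pq Sxp; have yS : y \in S :\ x by apply: Sxp; rewrite inE eqxx.
  have qS : {subset q <= S :\ x} by move=> z zq; apply: Sxp; rewrite inE zq orbT.
  have [yA|yA] := boolP (y \in A).
    left=> z; rewrite inE => /predU1P[->//|]; exact: prop clA pq yA qS _.
  have yB : y \in (S :\ x) :\: A by rewrite inE yA.
  right=> z; rewrite inE => /predU1P[->//|zq].
  by have := prop _ _ _ clB pq yB qS z zq; rewrite inE => /andP[].
move=> A clA A0; have [sA _] := closed_inP _ _ clA.
case: (allp A clA) => pA; last by rewrite (half A clA pA) eqxx in A0.
apply/eqP; rewrite eqEsubset sA -setD_eq0; apply/eqP.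
by apply: half; [apply: closed_inD | move=> y /pA yA; rewrite inE yA].
Qed.

End Graphs.

(** * Graphs without a Hamiltonian path *)

Section Traceability.
Variable T : finType.
Implicit Types (e : rel T) (S A B C : {set T}) (x y z : T) (p s : seq T).

(** Take a longest path. Without crossing neighbours its end degrees add up to at most 2m - 1, so
    one of them is below m. With crossing neighbours the path closes into a cycle, which must span
    [S] and is too long. *)
Lemma low_degree_end e S m : symmetric e -> irreflexive e ->
    conn e S -> paths_le e S m.*2 -> m.*2 < #|S| ->
  exists x, [/\ x \in S, deg e S x < m & conn e (S :\ x)].
Proof.
move=> e_sym e_irr cnS leS ltS.
have [x0 x0S] : exists x, x \in S by apply/set0Pn; rewrite -card_gt0; lia.
have [y [p lp]] := longest_path e x0S; rewrite -/(longest e S (y :: p)) in lp.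
have [ip maxp] := lp; have /and3P[_ _ /allP Sp] := ip.
have [crs|ncrs] := boolP (path (fun a b => ~~ (e (last y p) a && e y b)) y p).
  have := count_shift_lt crs; rewrite !e_irr => /(_ isT isT).
  rewrite -(deg_longest e_sym e_irr lp) -(deg_longest_last e_sym e_irr lp).
  have := leS _ ip; rewrite /= => le_p le_deg.
  have [lt_y|ge_y] := ltnP (deg e S y) m.
    exists y; split=> //; first by apply: Sp; rewrite inE eqxx.
    exact: conn_setD1_end lp.
  exists (last y p); split; first by apply: Sp; rewrite mem_last.
    by lia.
  apply: (@conn_setD1_end _ e e_sym e_irr _ _ (rev (belast y p)) cnS).
  by rewrite -rev_rcons -lastI; apply: longest_rev.
have [c [cc uc pc]] := crossing_cycle e_sym ip ncrs.
have Sc : {subset c <= S} by move=> z; rewrite (perm_mem pc); apply: Sp.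
have szc := perm_size pc.
have c0 : c != [::] by case: (c) szc.
have Sic : S =i c.
  by apply: (conn_cycle (L := size c) e_sym cnS _ cc uc Sc _ c0) => // q /maxp;
    rewrite szc.
have := leS _ ip; rewrite -szc -(card_uniqP uc) -(eq_card Sic); lia.
Qed.

(** The base bound [B] is left open; it will be 24 at 7 vertices and 46 at 9. *)
Lemma conn_vol e m n0 (B : nat) S : symmetric e -> irreflexive e ->
    m.*2 < n0 ->
    (forall A, conn e A -> paths_le e A m.*2 -> #|A| = n0 -> vol e A <= B) ->
    conn e S -> paths_le e S m.*2 -> n0 <= #|S| ->
  vol e S <= B + 2 * (m.-1 * (#|S| - n0)).
Proof.
move=> e_sym e_irr lt_n0 base; have [k] := ubnP #|S|; elim: k S => // k IHk S.
move=> lt_k cnS leS; rewrite leq_eqVlt => /predU1P[n0S|lt_S].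
  by apply: leq_trans (base S cnS leS (esym n0S)) _; rewrite leq_addr.
have lt_mS := ltn_trans lt_n0 lt_S.
have [x [xS degx cnSx]] := low_degree_end e_sym e_irr cnS leS lt_mS.
have cS := cardsD1 x S; rewrite xS /= in cS.
have {IHk} := IHk (S :\ x) _ cnSx (paths_le_subset (subsetDl _ _) leS) _.
rewrite (vol_setD1 e_sym e_irr xS).
have -> : #|S| - n0 = (#|S :\ x| - n0).+1 by lia.
by rewrite mulnS => IH; have := IH _ _; lia.
Qed.

(* A Hamiltonian path that uses one new edge xy is cut at that edge; two
   crossing neighbours of x and y would rearrange its halves. *)
Lemma ore_pair e S s1 x y s2 : symmetric e -> irreflexive e ->
    paths_le e S #|S|.-1 ->
    uniq (rcons s1 x ++ y :: s2) -> S =i rcons s1 x ++ y :: s2 ->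
    sorted e (rcons s1 x) -> sorted e (y :: s2) ->
  deg e S x + deg e S y + 2 <= #|S|.
Proof.
move=> e_sym e_irr noham up Sp.
have cS : #|S| = size (rcons s1 x ++ y :: s2).
  by rewrite (eq_card Sp) (card_uniqP up).
have ham q a b : walk e a q b -> perm_eq q (rcons s1 x ++ y :: s2) -> False.
  move=> /walk_sorted qs pq; have : ipath e S q.
    rewrite /ipath qs (perm_uniq pq) up /=; apply/allP=> z.
    by rewrite (perm_mem pq) -Sp.
  by move/noham; rewrite (perm_size pq) -cS cS size_cat size_rcons /=; lia.
have Sp' : {subset rcons s1 x ++ y :: s2 <= S} by move=> z; rewrite -Sp.
have dg z : deg e S z = count (e z) (rcons s1 x) + count (e z) (y :: s2).
  by rewrite -count_cat; apply: deg_count => // t; rewrite Sp.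
rewrite cS size_cat !dg; case def_s: (rcons s1 x) => [|a s]; first by case: (s1) def_s.
have last_s : last a s = x by rewrite -[last a s]/(last x (a :: s)) -def_s last_rcons.
rewrite def_s in ham => so1 so2.
have w1 := sorted_walk so1; have w2 := sorted_walk so2; rewrite last_s in w1.
have r1 := walk_rev e_sym w1; have r2 := walk_rev e_sym w2.
have crs1 : path (fun b c => ~~ (e x b && e y c)) a s.
  apply/negPn/negP; rewrite -[path _ _ _]/(sorted _ (a :: s)) => /not_sorted_split.
  case=> t1 [b [c [t2 [def_t]]]]; rewrite negbK => /andP[exb eyc].
  move: (w1); rewrite def_t => /walk_split[wt1 wt2 _].
  rewrite e_sym in exb; rewrite e_sym in eyc.
  apply: (ham _ _ _ (walk_cat wt1 (walk_cat (walk_rev e_sym wt2) w2 eyc) exb)).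
  by rewrite def_t catA perm_cat2r perm_cat2l perm_rev.
have crs2 : path (fun b c => ~~ (e x b && e y c)) y s2.
  apply/negPn/negP; rewrite -[path _ _ _]/(sorted _ (y :: s2)) => /not_sorted_split.
  case=> t1 [b [c [t2 [def_t]]]]; rewrite negbK => /andP[exb eyc].
  move: (w2); rewrite def_t => /walk_split[wt1 wt2 _].
  apply: (ham _ _ _ (walk_cat w1 (walk_cat (walk_rev e_sym wt1) wt2 eyc) exb)).
  by rewrite def_t perm_cat2l perm_cat2r perm_rev.
have nya : ~~ e y a.
  apply/negP=> eya; rewrite e_sym in eya.
  by apply: (ham _ _ _ (walk_cat r1 w2 eya)); rewrite perm_cat2r perm_rev.
have nxl : ~~ e x (last y s2).
  apply/negP=> exl.
  by apply: (ham _ _ _ (walk_cat w1 r2 exl)); rewrite perm_cat2l perm_rev.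
have := count_shift_lt crs1; rewrite last_s e_irr => /(_ isT nya) le1.
have := count_shift_lt crs2; rewrite e_irr => /(_ nxl isT) le2.
by rewrite addn2 addnACA [size (a :: s)]/= [size (y :: s2)]/= addSn addnS !ltnS leq_add.
Qed.

(** [h] is a maximal extension of [e] without a Hamiltonian path on [S]: adding a missing edge
    creates one, which must use that edge, and [ore_pair] applies to it. Relations become sets of
    ordered pairs so that finiteness yields a maximal one. *)
Lemma ore_closure e S : symmetric e -> irreflexive e -> paths_le e S #|S|.-1 ->
  exists h : rel T, [/\ symmetric h, irreflexive h, paths_le h S #|S|.-1,
    {in S &, subrel e h} &
    {in S &, forall x y, x != y -> ~~ h x y -> deg h S x + deg h S y + 2 <= #|S|}].
Proof.
(* The empty set is treated apart: there the empty tuple would count as a Hamiltonian path and [Q]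
   below could never hold. *)
move=> e_sym e_irr noham; have [->|[x0 x0S]] := set_0Vmem S.
  exists e; split=> // [p|x y]; last by rewrite inE.
  by move=> /ipath_leq_card; rewrite cards0.
pose r (E : {set T * T}) : rel T := fun x y => (x, y) \in E.
pose Q E := [&& [forall x, forall y, r E x y == r E y x],
  [forall x, ~~ r E x x], [forall x, forall y, e x y ==> r E x y]
  & ~~ [exists p : #|S|.-tuple T, ipath (r E) S p]].
have QP E : reflect [/\ symmetric (r E), irreflexive (r E), subrel e (r E)
                      & paths_le (r E) S #|S|.-1] (Q E).
  apply: (iffP and4P) => [] [sy ir su nh]; split.
  - by move=> x y; apply/eqP/(forallP (forallP sy x)).
  - by move=> x; apply/negbTE/(forallP ir).
  - by move=> x y; apply/implyP/(forallP (forallP su x)).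
  - move=> p ip; have := ipath_leq_card ip; rewrite leq_eqVlt => /predU1P[sz|]; last lia.
    case/negP: nh; apply/existsP; rewrite -sz; exists (in_tuple p).
    by [].
  - by apply/forallP=> x; apply/forallP=> y; rewrite sy.
  - by apply/forallP=> x; rewrite ir.
  - by apply/forallP=> x; apply/forallP=> y; apply/implyP; apply: su.
  apply/existsP=> -[p /nh]; rewrite size_tuple.
  have: 0 < #|S| by apply/card_gt0P; exists x0.
  by lia.
have Qe : Q [set q | e q.1 q.2].
  apply/QP; have re : r [set q | e q.1 q.2] =2 e by move=> x y; rewrite /r inE.
  split=> [x y|x|x y|p]; rewrite ?re //.
  case/and3P=> up ep Sp; apply: noham; apply/and3P; split=> //.
  by case: (p) ep => //= y q; rewrite (eq_path re).
have [E /maxsetP[/QP[sy ir su nh] maxE] _] := maxset_exists Qe.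
exists (r E); split=> // [x y _ _|x y xS yS xy nxy]; first exact: su.
pose E' := E :|: [set (x, y); (y, x)].
have rE' a b : r E' a b = r E a b || [|| (a == x) && (b == y) | (a == y) && (b == x)].
  by rewrite /r !inE !xpair_eqE.
have nQ : ~~ Q E'.
  apply: contra nxy => /maxE; rewrite subsetUl => /(_ isT) <-.
  by rewrite rE' !eqxx orbT.
have [p ip szp] : exists2 p, ipath (r E') S p & size p = #|S|.
  move: nQ; rewrite /Q => /nandP[/negP[]|/nandP[/negP[]|/nandP[/negP[]|]]].
  - apply/forallP=> a; apply/forallP=> b; rewrite !rE' sy.
    by rewrite [X in _ || X == _]orbC ![(b == _) && _]andbC.
  - apply/forallP=> a; rewrite rE' ir /= negb_or.
    by have [->|] := eqVneq a x; rewrite ?(negbTE xy) ?andbF.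
  - by apply/forallP=> a; apply/forallP=> b; apply/implyP=> /su; rewrite rE' => ->.
  by rewrite negbK => /existsP[p ip]; exists p; rewrite ?size_tuple.
have /and3P[up rp /allP Sp] := ip.
have pS : S =i p.
  have cp : #|p| = #|S| by rewrite (card_uniqP up).
  by move=> z; rewrite (elimT (subset_cardP cp)) //; apply/subsetP.
have : ~~ sorted (r E) p.
  apply/negP=> so; have : ipath (r E) S p by rewrite /ipath up so; apply/allP.
  have S_gt0 : 0 < #|S| by apply/card_gt0P; exists x0.
  by move/nh; rewrite szp -ltnS prednK // ltnn.
case/not_sorted_split=> s1 [a [b [s2 [def_p nab]]]].
rewrite def_p in up rp pS; have sr := rp.
have wp : exists c d, walk (r E') c (rcons s1 a ++ b :: s2) d.
  case: (rcons s1 a) rp => [|c s] rp; [exists b|exists c].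
    by exists (last b s2); apply: sorted_walk.
  by exists (last c (s ++ b :: s2)); apply: sorted_walk.
have [c [d /walk_split[/walk_sorted so1 /walk_sorted so2 rab]]] := wp.
have {}rab : (a = x /\ b = y) \/ (a = y /\ b = x).
  move: rab; rewrite rE' (negbTE nab) /=.
  by case/orP=> /andP[/eqP-> /eqP->]; [left|right].
have key : deg (r E) S a + deg (r E) S b + 2 <= #|S|.
  have disj z : z \in rcons s1 a -> z \in b :: s2 -> False.
    move=> z1 z2; move: up; rewrite cat_uniq => /and3P[_ /hasP[]].
    by exists z.
  apply: (@ore_pair _ _ s1 a b s2) => //.
    have nb z : z \in rcons s1 a -> z == b = false.
      by move=> z1; apply/negP=> /eqP zb; apply: (disj z); rewrite // zb inE eqxx.
    apply: (sub_in_sorted (P := [in rcons s1 a]) _ (allss _) so1) => u v u1 v1.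
    by rewrite rE'; case: rab => -[<- <-]; rewrite (nb u u1) (nb v v1) ?andbF !orbF.
  have na z : z \in b :: s2 -> z == a = false.
    move=> z2; apply/negP=> /eqP za; apply: (disj z); rewrite // za.
    by rewrite mem_rcons inE eqxx.
  apply: (sub_in_sorted (P := [in b :: s2]) _ (allss _) so2) => u v u2 v2.
  by rewrite rE'; case: rab => -[<- <-]; rewrite (na u u2) (na v v2) ?andbF !orbF.
by case: rab key => -[-> ->]; rewrite // [deg _ _ y + _]addnC.
Qed.

(* Chvatal's degree argument: the pair u, v is a non-adjacent pair of maximal
   degree sum in the closure h. *)
Lemma chvatal_pair e S : symmetric e -> irreflexive e -> 0 < #|S| ->
    paths_le e S #|S|.-1 ->
  exists (h : rel T) u v, [/\ symmetric h, irreflexive h, paths_le h S #|S|.-1,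
    {in S &, subrel e h} & [/\ u \in S, v \in S,
      deg h S u <= deg h S v, deg h S u + deg h S v + 2 <= #|S| &
      [/\ u != v, ~~ h u v,
      forall w, w \in S -> w != v -> ~~ h v w -> deg h S w <= deg h S u &
      forall w, w \in S -> w != u -> ~~ h u w -> deg h S w <= deg h S v]]].
Proof.
move=> e_sym e_irr S_gt0 noham.
have [h [h_sym h_irr nh su ore]] := ore_closure e_sym e_irr noham.
pose P (q : T * T) := [&& q.1 \in S, q.2 \in S, q.1 != q.2 & ~~ h q.1 q.2].
have [q0 Pq0] : exists q, P q.
  have [/existsP//|noP] := boolP [exists q, P q].
  (* If every two distinct vertices were adjacent in [h], any enumeration of [S] would be a
     Hamiltonian path. *)
  have : ipath h S (enum S).
    apply/and3P; split; [exact: enum_uniq | | by apply/allP=> z; rewrite mem_enum].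
    have: uniq (enum S) := enum_uniq _.
    have: {subset enum S <= S} by move=> z; rewrite mem_enum.
    elim: (enum S) => //= a [|b s] //= IHs ss /andP[ha us].
    rewrite IHs ?andbT //; last by move=> z zs; apply: ss; rewrite inE zs orbT.
    have [aS bS] : a \in S /\ b \in S by split; apply: ss; rewrite !inE eqxx ?orbT.
    apply/negPn/negP=> nab; case/negP: noP; apply/existsP; exists (a, b).
    by rewrite /P /= aS bS nab andbT; apply: contraNneq ha => ->; rewrite inE eqxx.
  by move/nh; rewrite -cardE; lia.
have [[u v] /and4P[/= uS vS uv nuv] maxuv] :=
  arg_maxnP (fun q => deg h S q.1 + deg h S q.2) Pq0.
have max1 w : w \in S -> w != v -> ~~ h v w -> deg h S w <= deg h S u.
  move=> wS wv nvw; have /maxuv : P (w, v) by rewrite /P /= wS vS wv h_sym.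
  by rewrite leq_add2r.
have max2 w : w \in S -> w != u -> ~~ h u w -> deg h S w <= deg h S v.
  move=> wS wu nuw; have /maxuv : P (u, w) by rewrite /P /= wS uS eq_sym wu.
  by rewrite leq_add2l.
have sum := ore u v uS vS uv nuv.
have [le_uv|/ltnW le_vu] := leqP (deg h S u) (deg h S v).
  by exists h, u, v; do !split.
rewrite [deg h S u + _]addnC in sum; rewrite eq_sym in uv; rewrite h_sym in nuv.
by exists h, v, u; do !split.
Qed.

End Traceability.

(** * Dense connected graphs *)

Section DenseConnected.
Variable T : finType.
Implicit Types (e : rel T) (S A B C D K L R Z : {set T}) (x y z : T) (p s : seq T).

Lemma subset_of_card A k : k <= #|A| -> exists2 B : {set T}, B \subset A & #|B| = k.
Proof.
move=> le_k; exists [set x in take k (enum A)].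
  by apply/subsetP=> x; rewrite inE => xs; have := mem_take xs; rewrite mem_enum.
rewrite cardsE (card_uniqP (take_uniq _ (enum_uniq _))).
by rewrite size_takel -?cardE.
Qed.

Lemma sum_eq_pointwise (I : finType) (A : {set I}) (f g : I -> nat) :
    (forall i, i \in A -> f i <= g i) -> \sum_(i in A) g i <= \sum_(i in A) f i ->
  forall i, i \in A -> f i = g i.
Proof.
move=> le_fg le_sum i iA; apply/eqP; rewrite eqn_leq le_fg //= leqNgt.
apply/negP=> lt_i; move: le_sum; rewrite leqNgt => /negP[].
rewrite (bigD1 i iA) [X in _ < X](bigD1 i iA) /= -addSn leq_add //.
by apply: leq_sum => j /andP[jA _]; apply: le_fg.
Qed.

Lemma deg_subrel e h S x : {in S &, subrel e h} -> x \in S -> deg e S x <= deg h S x.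
Proof.
move=> sub xS; apply/subset_leq_card/subsetP=> y; rewrite !inE => /andP[yS exy].
by rewrite yS sub.
Qed.

Lemma vol_subrel e h S : {in S &, subrel e h} -> vol e S <= vol h S.
Proof. by move=> sub; apply: leq_sum => x; apply: deg_subrel. Qed.

Lemma deg_eq0 e S x y : deg e S x = 0 -> y \in S -> e x y = false.
Proof.
move=> /eqP; rewrite cards_eq0 => /eqP/setP/(_ y); rewrite !inE => + yS.
by rewrite yS.
Qed.

Lemma deg_gt0 e S x : conn e S -> x \in S -> 1 < #|S| -> 0 < deg e S x.
Proof.
move=> cnS xS S_gt1; rewrite lt0n; apply/eqP=> deg0.
have cl : closed_in e S [set x].
  apply/closed_inP; rewrite sub1set; split=> // a y /set1P-> yS.
  by rewrite (deg_eq0 deg0 yS).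
have x0 : [set x] != set0 by apply/set0Pn; exists x; rewrite inE.
by rewrite -(cnS _ cl x0) cards1 in S_gt1.
Qed.

(* Chvatal's condition, read for the closure h of e. *)
Lemma chvatal e S : symmetric e -> irreflexive e -> 1 < #|S| -> conn e S ->
    paths_le e S #|S|.-1 ->
  exists (h : rel T) k L R, [/\ symmetric h, irreflexive h, {in S &, subrel e h},
    0 < k /\ 2 * k + 2 <= #|S|
    & [/\ L \subset S, #|L| = k.+1, R \subset S, #|R| = #|S| - k &
      {in L, forall x, deg h S x <= k} /\ {in R, forall x, deg h S x <= #|S| - k - 2}]].
Proof.
move=> e_sym e_irr S_gt1 cnS noham.
have [h [u [v []]]] := chvatal_pair e_sym e_irr (ltnW S_gt1) noham.
move=> h_sym h_irr _ sub [uS vS le_uv sum_le [uv nuv maxu maxv]].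
(* With [k] the degree of [u], maximality of the pair bounds degrees in [A] by [k] and degrees in
   [R] by that of [v]. [A] leaves out [v] and still has at least [k.+1] vertices by the degree-sum
   bound; [R] keeps [u], whence its size [#|S| - k]. *)
pose A := [set w in S | (w != v) && ~~ h v w]; pose R := [set w in S | ~~ h u w].
have cR : #|R| = #|S| - deg h S u.
  rewrite -[#|S|](cardsID [set w | h u w]) /deg.
  have -> : S :&: [set w | h u w] = [set w in S | h u w] by apply/setP=> w; rewrite !inE.
  rewrite addKn; apply: eq_card => w; by rewrite !inE andbC.
have cA : #|A| = #|S| - deg h S v - 1.
  have -> : A = [set w in S | ~~ h v w] :\ v.
    by apply/setP=> w; rewrite !inE andbCA.
  have := cardsD1 v [set w in S | ~~ h v w]; rewrite !inE vS h_irr /=.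
  rewrite -[#|S|](cardsID [set w | h v w]) /deg.
  have -> : S :&: [set w | h v w] = [set w in S | h v w] by apply/setP=> w; rewrite !inE.
  rewrite addKn; have -> : S :\: [set w | h v w] = [set w in S | ~~ h v w].
    by apply/setP=> w; rewrite !inE andbC.
  by lia.
have [L sLA cL] : exists2 L : {set T}, L \subset A & #|L| = (deg h S u).+1.
  by apply: subset_of_card; rewrite cA; move: sum_le; clear; lia.
have u_gt0 : 0 < deg h S u.
  exact: leq_trans (deg_gt0 cnS uS S_gt1) (deg_subrel sub uS).
exists h, (deg h S u), L, R; split=> //; first by split=> //; lia.
have sAS : A \subset S by apply/subsetP=> w; rewrite inE => /andP[].
split=> //; first exact: subset_trans sLA sAS.
  by apply/subsetP=> w; rewrite inE => /andP[].
split=> w; first by move/(subsetP sLA); rewrite inE => /and3P[]; apply: maxu.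
rewrite inE => /andP[wS nuw]; have [->|wu] := eqVneq w u; first by lia.
by have := maxv w wS wu nuw; lia.
Qed.

(** Every edge meeting [L] is charged to its ends in [L]. The term [vol h L] is kept because the
    equality case has to show that [L] is independent. *)
Lemma chvatal_vol h S L k : symmetric h -> irreflexive h -> L \subset S ->
    #|L| = k.+1 -> {in L, forall x, deg h S x <= k} ->
  vol h S + vol h L <= vol h (S :\: L) + 2 * (k.+1 * k).
Proof.
move=> h_sym h_irr sLS cL degL; rewrite (vol_sum_deg h_sym sLS) leq_add2l leq_mul2l /=.
by rewrite -cL -sum_nat_const leq_sum.
Qed.

(** [k] is 1 or 2, giving 5 * 4 + 4 and 4 * 3 + 12, both equal to 24. *)
Lemma vol_conn7 e S : symmetric e -> irreflexive e -> conn e S ->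
  paths_le e S 6 -> #|S| = 7 -> vol e S <= 24.
Proof.
move=> e_sym e_irr cnS leS S7.
have := chvatal e_sym e_irr _ cnS; rewrite S7 => /(_ isT leS).
case=> h [k [L [R [h_sym h_irr sub [k0 le_k] [sL cL _ _ [degL _]]]]]].
apply: leq_trans (vol_subrel sub) _; have := chvatal_vol h_sym h_irr sL cL degL.
have := vol_le_card h_irr (S :\: L); rewrite cardsD (setIidPr sL) S7 cL.
by case: k k0 le_k cL degL => [|[|[|k]]] /= k0 le_k _ _; lia.
Qed.

(** For [k] equal to 1, 2, 3 the bounds are 42 + 4, 30 + 12 and 20 + 24; the first, 46, is the
    largest. *)
Lemma vol_conn9 e S : symmetric e -> irreflexive e -> conn e S ->
  paths_le e S 8 -> #|S| = 9 -> vol e S <= 46.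
Proof.
move=> e_sym e_irr cnS leS S9.
have := chvatal e_sym e_irr _ cnS; rewrite S9 => /(_ isT leS).
case=> h [k [L [R [h_sym h_irr sub [k0 le_k] [sL cL _ _ [degL _]]]]]].
apply: leq_trans (vol_subrel sub) _; have := chvatal_vol h_sym h_irr sL cL degL.
have := vol_le_card h_irr (S :\: L); rewrite cardsD (setIidPr sL) S9 cL.
by case: k k0 le_k cL degL => [|[|[|[|k]]]] /= k0 le_k _ _; lia.
Qed.

(* The extremal graph: K is complete and joined to everything else, and D spans
   the only edge off K. *)
Definition core3 e S K D :=
  [/\ K \subset S, D \subset S :\: K, #|K| = 3, #|D| = 2 &
    {in S &, forall x y, x != y ->
       e x y = [|| x \in K, y \in K | (x \in D) && (y \in D)]}].

Lemma deg_full e S x y : irreflexive e -> x \in S -> deg e S x = #|S|.-1 ->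
  y \in S -> x != y -> e x y.
Proof.
move=> e_irr xS degx yS xy.
have sub : [set z in S | e x z] \subset S :\ x.
  apply/subsetP=> z; rewrite !inE => /andP[-> exz]; rewrite andbT.
  by apply: contraTneq exz => ->; rewrite e_irr.
have /eqP eq_sets : [set z in S | e x z] == S :\ x.
  by rewrite eqEcard sub [X in _ <= X]degx (cardsD1 x S) xS /=.
have : y \in S :\ x by rewrite !inE eq_sym xy.
by rewrite -eq_sets inE => /andP[_ ->].
Qed.

(** Among the bounds 46, 42, 44 for [k] = 1, 2, 3, the value 44 excludes [k] = 2. For [k] = 1 the
    set [L] consists of two vertices of degree at most 1; for [k] = 3 all estimates are equalities,
    which determines the graph and forces [e] to agree with [h]. *)
Lemma dense9 e S : symmetric e -> irreflexive e -> conn e S ->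
    paths_le e S 8 -> #|S| = 9 -> 44 <= vol e S ->
  (exists x y, [/\ x \in S, y \in S, x != y, deg e S x <= 1 & deg e S y <= 1]) \/
  exists K D, core3 e S K D.
Proof.
move=> e_sym e_irr cnS leS S9 volS.
have := chvatal e_sym e_irr _ cnS; rewrite S9 => /(_ isT leS).
case=> h [k [L [M [h_sym h_irr sub [k0 le_k] [sL cL sM cM [degL degM]]]]]].
have vol_eh := vol_subrel sub.
pose R := S :\: L; have cR : #|R| = 9 - k.+1 by rewrite cardsD (setIidPr sL) S9 cL.
have volR := vol_le_card h_irr R; have volL := chvatal_vol h_sym h_irr sL cL degL.
rewrite -/R cR in volR volL.
case: k k0 le_k cL cM cR degL degM volR volL
  => [|[|[|[|k]]]] //= _ le_k cL cM cR; last by lia.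
- move=> degL _ _ _; left; move/eqP/cards2P: cL => [x [y [xy defL]]].
  have [xL yL] : x \in L /\ y \in L by rewrite defL !inE !eqxx orbT.
  exists x, y; split=> //; try exact: (subsetP sL).
    by apply: leq_trans (deg_subrel sub _) (degL x xL); apply: (subsetP sL).
  by apply: leq_trans (deg_subrel sub _) (degL y yL); apply: (subsetP sL).
- by lia.
move=> degL degM volR volL; right.
have volL0 : vol h L = 0 by lia.
have volR20 : vol h R = 20 by lia.
have sumL : \sum_(x in L) deg h S x = 12.
  have := vol_sum_deg h_sym sL; rewrite -/R volL0 volR20.
  have : \sum_(x in L) deg h S x <= 12.
    by rewrite -[12]/(4 * 3) -cL -sum_nat_const leq_sum.
  by lia.
have degL3 x : x \in L -> deg h S x = 3.
  by apply: sum_eq_pointwise x => //; rewrite sum_nat_const cL sumL.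
have degR4 x : x \in R -> deg h R x = 4.
  apply: sum_eq_pointwise x => [x xR|].
    by have := deg_lt_card h_irr xR; rewrite cR.
  by rewrite sum_nat_const cR -/(vol h R) volR20.
have degL0 x : x \in L -> deg h L x = 0.
  move=> xL; apply/esym; move: x xL; apply: sum_eq_pointwise => //.
  by rewrite -/(vol h L) volL0.
have eh : {in S &, e =2 h}.
  have eq_deg x : x \in S -> deg e S x = deg h S x.
    apply: sum_eq_pointwise x => [x|]; first exact: deg_subrel.
    by rewrite -/(vol h S) -/(vol e S); lia.
  move=> x y xS yS; have /eqP/setP/(_ y) : [set z in S | e x z] == [set z in S | h x z].
    rewrite eqEcard -!/(deg _ S x) (eq_deg x xS) leqnn andbT.
    by apply/subsetP=> z; rewrite !inE => /andP[zS exz]; rewrite zS sub.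
  by rewrite !inE yS.
have sRS : R \subset S := subsetDl _ _.
(* [M] has 6 and [R] has 5 of the 9 vertices, so they share two. Vertices of [M] have degree at most
   4, which those in [R] already spend inside the complete graph on [R]; hence [D] has no neighbours
   in [L]. *)
have [D sD cD] : exists2 D : {set T}, D \subset M :&: R & #|D| = 2.
  apply: subset_of_card.
  have := cardsUI M R; have : #|M :|: R| <= 9.
    by rewrite -S9 subset_leq_card // subUset sM.
  by rewrite cM cR; lia.
have [sDM sDR] : D \subset M /\ D \subset R by apply/andP; rewrite -subsetI.
have degD x : x \in D -> deg h L x = 0.
  move=> xD; have := degM x (subsetP sDM x xD).
  rewrite (deg_setD h x sL) -/R (degR4 x (subsetP sDR x xD)).
  by lia.
exists (R :\: D), D; split=> //.
- exact: subset_trans (subsetDl _ _) sRS.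
- apply/subsetP=> x xD; rewrite !inE xD /=.
  by have := subsetP sRS x (subsetP sDR x xD).
- by rewrite cardsD (setIidPr sDR) cR cD.
have LK x y : x \in L -> y \in R -> h x y = (y \notin D).
  move=> xL yR; have xS := subsetP sL x xL.
  have /eqP/setP/(_ y) : [set z in S | h x z] == R :\: D.
    rewrite eqEcard -/(deg h S x) (degL3 x xL) cardsD (setIidPr sDR) cR cD andbT.
    apply/subsetP=> z; rewrite !inE => /andP[zS hxz]; rewrite zS andbT.
    have -> /= : z \notin D.
      by apply/negP=> zD; rewrite h_sym (deg_eq0 (degD z zD) xL) in hxz.
    by apply/negP=> zL; rewrite (deg_eq0 (degL0 x xL) zL) in hxz.
  by rewrite [in LHS]inE [in RHS]inE (subsetP sRS y yR) yR andbT.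
move=> x y xS yS xy; rewrite eh //; have := subsetP sDR x; have := subsetP sDR y.
have inR z : z \in S -> (z \in R) = (z \notin L) by move=> zS; rewrite inE zS andbT.
have inK z : z \in R :\: D = (z \notin D) && (z \in R) by rewrite inE.
rewrite !inK !inR //.
have [xL|xL] := boolP (x \in L); have [yL|yL] := boolP (y \in L) => /=.
- rewrite (deg_eq0 (degL0 x xL) yL) !andbF /= => _ xD.
  by apply/esym/negP=> /andP[/xD].
- have yR : y \in R by rewrite inR.
  rewrite LK // !andbF !andbT /= => _ xD.
  by case: (x \in D) xD => [/(_ isT)|]; rewrite ?orbF.
- have xR : x \in R by rewrite inR.
  rewrite h_sym LK // !andbF !andbT /= => yD _.
  by case: (y \in D) yD => [/(_ isT)|]; rewrite ?andbF ?orbF.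
have [xR yR] : x \in R /\ y \in R by rewrite !inR.
rewrite (deg_full h_irr xR _ yR xy) ?degR4 ?cR // => _ _.
by case: (x \in D); case: (y \in D).
Qed.

End DenseConnected.

(** * Extremal connected graphs without a path on nine vertices *)

Section Extremal.
Variable T : finType.
Implicit Types (e : rel T) (S A B C D K L R Z : {set T}) (x y z : T) (p q s : seq T).

Lemma uniq_seq_of_card A k : k <= #|A| ->
  exists s, [/\ uniq s, size s = k & {subset s <= A}].
Proof.
move=> le_k; exists (take k (enum A)); split; first by rewrite take_uniq ?enum_uniq.
  by rewrite size_takel -?cardE.
by move=> x xs; have := mem_take xs; rewrite mem_enum.
Qed.

(** 40 is two below 7 * 6, so at most two vertices have degree less than 6, and every missing pair
    must be that pair. *)
Lemma missing_edge7 e Z x y z w : irreflexive e -> #|Z| = 7 -> 40 <= vol e Z ->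
    x \in Z -> y \in Z -> x != y -> ~~ e x y -> ~~ e y x ->
    z \in Z -> w \in Z -> z != w -> ~~ e z w -> ~~ e w z ->
  [set x; y] = [set z; w].
Proof.
move=> e_irr Z7 volZ; pose B := [set u in Z | deg e Z u < 6].
have cB : #|B| <= 2.
  have : vol e Z + #|B| <= \sum_(u in Z) 6.
    have -> : #|B| = \sum_(u in Z) (deg e Z u < 6).
      rewrite -sum1_card (eq_bigl (fun u => (u \in Z) && (deg e Z u < 6))).
        by rewrite big_mkcondr; apply: eq_bigr => u _; case: (_ < _).
      by move=> u; rewrite inE.
    rewrite -big_split; apply: leq_sum => u uZ /=.
    by have := deg_lt_card e_irr uZ; rewrite Z7; case: ltngtP => //; lia.
  by rewrite sum_nat_const Z7; lia.
have inB u v : u \in Z -> v \in Z -> u != v -> ~~ e u v -> u \in B.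
  move=> uZ vZ uv nuv; rewrite inE uZ /=.
  have : deg e Z u <= #|(Z :\ u) :\ v|.
    apply/subset_leq_card/subsetP=> t; rewrite !inE => /andP[-> eut]; rewrite andbT.
    by apply/andP; split; apply: contraTneq eut => ->; rewrite ?e_irr.
  have := cardsD1 u Z; have := cardsD1 v (Z :\ u).
  by rewrite !inE uZ vZ eq_sym uv Z7 /=; lia.
have eqB u v : u \in Z -> v \in Z -> u != v -> ~~ e u v -> ~~ e v u ->
    [set u; v] = B.
  move=> uZ vZ uv nuv nvu; apply/eqP; rewrite eqEcard subUset !sub1set.
  rewrite (inB u v) // (inB v u) //; last by rewrite eq_sym.
  by rewrite cards2 uv.
by move=> xZ yZ xy nxy nyx zZ wZ zw nzw nwz; rewrite !eqB.
Qed.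

(* Two edge-disjoint Hamiltonian paths with the same ends: at most one of
   them can use the missing edge. *)
Lemma ham_conn7 e Z a b : symmetric e -> irreflexive e -> #|Z| = 7 ->
    40 <= vol e Z -> a \in Z -> b \in Z -> a != b ->
  exists q, [/\ walk e a q b, uniq q, size q = 7 & {subset q <= Z}].
Proof.
move=> e_sym e_irr Z7 volZ aZ bZ ab.
have [s [us ss sZ]] : exists s, [/\ uniq s, size s = 5 & {subset s <= (Z :\ a) :\ b}].
  apply: uniq_seq_of_card; have := cardsD1 a Z; have := cardsD1 b (Z :\ a).
  by rewrite !inE aZ bZ eq_sym ab Z7 /=; lia.
pose t := rcons (a :: s) b; pose f := nth a t.
have tZ : {subset t <= Z}.
  move=> x; rewrite mem_rcons !inE => /or3P[/eqP->//|/eqP->//|/sZ].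
  by rewrite !inE => /and3P[].
have ut : uniq t.
  have sab x : x \in s -> (x != b) && (x != a).
    by move/sZ; rewrite !inE => /and3P[-> ->].
  rewrite /= rcons_uniq mem_rcons inE (negbTE ab) us andbT /=.
  by apply/andP; split; apply/negP=> /sab; rewrite eqxx ?andbF.
have st : size t = 7 by rewrite size_rcons /= ss.
have fZ i : i < 7 -> f i \in Z by move=> i7; apply/tZ/mem_nth; rewrite st.
have fI i j : i < 7 -> j < 7 -> (f i == f j) = (i == j).
  by move=> i7 j7; rewrite /f nth_uniq ?st.
pose r i j := e (f i) (f j).
have only i0 j0 : i0 < 7 -> j0 < 7 -> i0 != j0 -> ~~ r i0 j0 ->
    forall i j, i < 7 -> j < 7 -> i != j ->
    ~~ ((i == i0) && (j == j0) || (i == j0) && (j == i0)) -> r i j.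
  move=> i07 j07 ij0 nr i j i7 j7 ij; apply: contraR => nrij.
  have /setP E : [set f i0; f j0] = [set f i; f j].
    by apply: missing_edge7 volZ _ _ _ _ _ _ _ _ _ _;
      rewrite ?fZ ?fI // 1?e_sym.
  have := E (f i); have := E (f j); rewrite !inE !eqxx ?orbT !fI //.
  have := E (f i0); rewrite !inE eqxx !fI //.
  move=> /esym/orP[]/eqP ei /orP[]/eqP ej /orP[]/eqP ek; move: ij ij0;
    by rewrite ?ei ?ej ?ek ?eqxx ?orbT //; move: ei ej ek; lia.
have def_t : t = [:: f 0; f 1; f 2; f 3; f 4; f 5; f 6].
  apply: (@eq_from_nth _ a); rewrite st // => i.
  by do 7?[case: i => [|i] //].
have [ok|bad] := boolP (sorted e t).
  exists t; split=> //.
  by have := @sorted_walk _ e a (rcons s b) ok; rewrite last_rcons.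
pose t' := [:: f 0; f 3; f 5; f 2; f 4; f 1; f 6].
have pt : perm_eq t' t.
  rewrite def_t; apply/permP=> P /=; do 7!move: (nat_of_bool (P _)) => ?.
  by clear; lia.
exists t'; split; last by move=> x; rewrite (perm_mem pt); apply: tZ.
- have -> : b = f 6 by rewrite /f /t nth_rcons /= ss.
  rewrite /walk /= eqxx eqxx !andbT.
  move: bad; rewrite def_t /= -!/(r _ _) !andbT.
  have dec i j : i < 7 -> j < 7 -> i != j -> r i j \/ forall i' j', i' < 7 ->
      j' < 7 -> i' != j' -> 
    ~~ ((i' == i) && (j' == j) || (i' == j) && (j' == i)) -> r i' j'.
    by move=> i7 j7 ij; case: (boolP (r i j)) => [|nr]; [left|right; apply: only].
  have [->|h] := dec 0 1 isT isT isT; last by move=> _; rewrite !h.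
  have [->|h] := dec 1 2 isT isT isT; last by move=> _; rewrite !h.
  have [->|h] := dec 2 3 isT isT isT; last by move=> _; rewrite !h.
  have [->|h] := dec 3 4 isT isT isT; last by move=> _; rewrite !h.
  have [->|h] := dec 4 5 isT isT isT; last by move=> _; rewrite !h.
  by have [->|h] := dec 5 6 isT isT isT; last by move=> _; rewrite !h.
- by rewrite (perm_uniq pt).
by rewrite (perm_size pt).
Qed.

(** Removing the leaves [x] and [y] leaves seven vertices [Z] with at most one edge missing, hence
    Hamiltonian paths between any two ends. Distinct attachment points of the leaves would give a
    path on nine vertices, so both hang from one vertex [a]. A neighbour of [z] other than [a],
    whether a leaf or in [Z], gives nine vertices again. *)
Lemma two_leaves9 e S x y z : symmetric e -> irreflexive e -> conn e S ->
    #|S| = 9 -> 44 <= vol e S -> x \in S -> y \in S -> x != y ->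
    deg e S x <= 1 -> deg e S y <= 1 -> z \notin S -> paths_le e (z |: S) 8 ->
  deg e S z <= 1.
Proof.
move=> e_sym e_irr cnS S9 volS xS yS xy degx degy zS leS.
have nbr u : u \in S -> deg e S u <= 1 ->
    exists2 a, a \in S & forall w, w \in S -> e u w = (w == a).
  move=> uS degu; have /cards1P[a defN] : #|[set w in S | e u w]| == 1.
    by rewrite eqn_leq degu deg_gt0 ?S9.
  have : a \in [set w in S | e u w] by rewrite defN set11.
  rewrite inE => /andP[aS _]; exists a => // w wS.
  by move/setP: defN => /(_ w); rewrite !inE wS.
have [[a aS xE] [b bS yE]] := (nbr x xS degx, nbr y yS degy).
have nxy : ~~ e x y.
  apply/negP=> exy; have eyx : e y x by rewrite e_sym.
  have ya : y = a by apply/eqP; rewrite -xE.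
  have xb : x = b by apply/eqP; rewrite -yE.
  have cl : closed_in e S [set x; y].
    apply/closed_inP; rewrite subUset !sub1set xS; split=> // u w.
    rewrite !inE => /orP[]/eqP-> wS; first by rewrite xE // ya orbC => ->.
    by rewrite yE // -xb => ->.
  have : [set x; y] = S by apply: cnS => //; apply/set0Pn; exists x; rewrite !inE eqxx.
  by move/(congr1 (fun A : {set T} => #|A|)); rewrite cards2 xy S9.
pose Z := (S :\ x) :\ y; have yx : y != x by rewrite eq_sym.
have Z7 : #|Z| = 7.
  have := cardsD1 x S; have := cardsD1 y (S :\ x).
  by rewrite !inE xS yS yx S9 /= -/Z; clear; lia.
have volZ : 40 <= vol e Z.
  have := vol_setD1 e_sym e_irr xS.
  have ySx : y \in S :\ x by rewrite !inE yx.
  have := vol_setD1 e_sym e_irr ySx; have := deg_subset e y (subsetDl S [set x]).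
  by rewrite -/Z; move: volS degx degy; clear; lia.
have ZE u : u \in Z = [&& u != y, u != x & u \in S] by rewrite !inE.
have aZ : a \in Z.
  rewrite ZE aS andbT; apply/andP; split; apply/negP=> /eqP ea.
    by rewrite xE ?ea ?eqxx in nxy.
  by have := xE _ aS; rewrite eqxx ea e_irr.
have bZ : b \in Z.
  rewrite ZE bS andbT; apply/andP; split; apply/negP=> /eqP eb.
    by have := yE _ bS; rewrite eqxx eb e_irr.
  by rewrite e_sym yE ?eb ?eqxx in nxy.
have exa : e x a by rewrite xE.
have eyb : e y b by rewrite yE.
have Zx : x \notin Z by rewrite ZE eqxx andbF.
have Zy : y \notin Z by rewrite ZE eqxx.
have SZ : {subset Z <= S} by move=> u; rewrite ZE => /and3P[].
have no9 p u v : walk e u p v -> uniq p -> {subset p <= z |: S} -> size p <> 9.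
  move=> wp up sp sz; have : ipath e (z |: S) p.
    by rewrite /ipath up (walk_sorted wp); apply/allP.
  by move/leS; rewrite sz.
have zE u : u \in S -> u == z = false.
  by move=> uS; apply: contraNF zS => /eqP<-.
have ab : a = b.
  apply/eqP/negPn/negP=> ab.
  have [q [wq uq sq qZ]] := ham_conn7 e_sym e_irr Z7 volZ aZ bZ ab.
  rewrite e_sym in eyb.
  apply: (no9 (x :: rcons q y) x y); last by rewrite /= size_rcons sq.
  - exact: walk_cons exa (walk_rcons wq eyb).
  - rewrite /= rcons_uniq uq mem_rcons inE (negbTE xy) andbT /=.
    by apply/andP; split; apply/negP=> /qZ; apply/negP.
  move=> u; rewrite inE mem_rcons inE => /or3P[/eqP->|/eqP->|/qZ/SZ].
  - by rewrite !inE xS orbT.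
  - by rewrite !inE yS orbT.
  by rewrite !inE => ->; rewrite orbT.
rewrite -{}ab in bZ eyb *; rewrite leqNgt; apply/negP=> degz.
have [w [wS ezw wa]] : exists w, [/\ w \in S, e z w & w != a].
  have [/exists_inP[w wS /andP[ezw wa]]|none] :=
    boolP [exists w in S, e z w && (w != a)]; first by exists w.
  have : deg e S z <= #|[set a]|.
    apply/subset_leq_card/subsetP=> w; rewrite !inE => /andP[wS ezw].
    apply: contraNT none => wa; apply/exists_inP; exists w => //.
    by rewrite ezw.
  by rewrite cards1 leqNgt degz.
have leaf u : u \in S -> u \notin Z -> e u a -> w != u.
  move=> uS uZ eua; apply/eqP=> wu.
  have [t tZ at_] : exists2 t, t \in Z & a != t.
    have : 0 < #|Z :\ a| by move: (cardsD1 a Z); rewrite aZ Z7 add1n => -[<-].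
    by case/card_gt0P=> t; rewrite !inE -ZE eq_sym => /andP[ta tZ]; exists t.
  have [q [wq uq sq qZ]] := ham_conn7 e_sym e_irr Z7 volZ aZ tZ at_.
  apply: (no9 (z :: u :: q) z t); last by rewrite /= sq.
  - by rewrite -wu in eua *; apply: walk_cons ezw (walk_cons eua wq).
  - rewrite /= uq inE negb_or eq_sym zE //= andbT.
    apply/andP; split; apply/negP=> /qZ; last exact/negP.
    by move/SZ; apply/negP.
  move=> v; rewrite !inE => /or3P[->//|/eqP->|/qZ/SZ->]; rewrite ?uS ?orbT //.
have wZ : w \in Z by rewrite ZE wS !leaf.
have [q [wq uq sq qZ]] := ham_conn7 e_sym e_irr Z7 volZ wZ aZ wa.
rewrite e_sym in exa; apply: (no9 (z :: rcons q x) z x); last by rewrite /= size_rcons sq.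
- exact: walk_cons ezw (walk_rcons wq exa).
- rewrite /= rcons_uniq uq mem_rcons inE eq_sym zE //= andbT.
  apply/andP; split; apply/negP=> /qZ; last exact/negP.
  by move/SZ; apply/negP.
move=> v; rewrite !inE mem_rcons inE => /or3P[->//|/eqP->|/qZ/SZ->];
  by rewrite ?xS ?orbT.
Qed.

(** With n vertices: 3(n - 1) from [K], 2 * 4 from [D] and 3(n - 5) from the rest. *)
Lemma core3_vol e S K D : irreflexive e -> core3 e S K D ->
  vol e S + 10 <= 6 * #|S|.
Proof.
move=> e_irr [sK sD cK cD eE]; rewrite /vol (big_setID K) /= (setIidPr sK).
rewrite (big_setID (A := S :\: K) D) /= (setIidPr sD).
have [sKS sDS] := (subsetP sK, fun x xD => subsetP sD x xD).
have DS x : x \in D -> x \in S /\ x \notin K.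
  by move/sDS; rewrite inE => /andP[].
have ne x y : e x y -> x != y by apply: contraTneq => ->; rewrite e_irr.
have leK : \sum_(x in K) deg e S x <= 3 * #|S|.-1.
  rewrite -cK -sum_nat_const; apply: leq_sum => x xK.
  by have := deg_lt_card e_irr (sKS x xK); lia.
have leD : \sum_(x in D) deg e S x <= 2 * 4.
  rewrite -{1}cD -sum_nat_const; apply: leq_sum => x xD; have [xS xK] := DS x xD.
  have : deg e S x <= #|(K :|: D) :\ x|.
    apply/subset_leq_card/subsetP=> y; rewrite !inE => /andP[yS exy].
    have xy := ne _ _ exy; move: exy; rewrite eE // (negbTE xK) xD /=.
    by rewrite eq_sym xy.
  have := cardsD1 x (K :|: D); rewrite inE xD orbT.
  by have [leU _] := leq_card_setU K D; move: leU; rewrite cK cD; clear; lia.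
have leR : \sum_(x in S :\: K :\: D) deg e S x <= #|S :\: K :\: D| * 3.
  rewrite -sum_nat_const; apply: leq_sum => x; rewrite !inE => /and3P[xD xK xS].
  rewrite -cK; apply/subset_leq_card/subsetP=> y; rewrite inE => /andP[yS exy].
  have xy := ne _ _ exy; move: exy; rewrite eE // (negbTE xK) (negbTE xD) /=.
  by rewrite orbF.
have := cardsID K S; have := cardsID D (S :\: K).
by rewrite (setIidPr sK) (setIidPr sD) cK cD; lia.
Qed.

Lemma core3_vol_out e S K D : irreflexive e -> core3 e S K D -> vol e (S :\: K) <= 2.
Proof.
move=> e_irr [sK sD cK cD eE].
have -> : 2 = \sum_(x in S :\: K) (x \in D).
  rewrite -cD -sum1_card big_mkcond [RHS]big_mkcond; apply: eq_bigr => x _.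
  have [xD|xD] := boolP (x \in D); last by case: (x \in _).
  by rewrite (subsetP sD x xD).
apply: leq_sum => x; rewrite inE => /andP[xK xS].
have nbr y : y \in S :\: K -> e x y -> (x \in D) && (y \in D :\ x).
  rewrite !inE => /andP[yK yS] exy.
  have xy : x != y by apply: contraTneq exy => ->; rewrite e_irr.
  by move: exy; rewrite eE // (negbTE xK) (negbTE yK) eq_sym xy /=.
have [xD|xD] := boolP (x \in D).
  have c1 : #|D :\ x| = 1 by move: (cardsD1 x D); rewrite xD cD add1n => -[<-].
  apply: leq_trans (eq_leq c1).
  by apply/subset_leq_card/subsetP=> y; rewrite inE => /andP[yW /(nbr y yW)/andP[]].
rewrite leqn0 cards_eq0; apply/eqP/setP=> y; rewrite [RHS]inE inE.
by apply/negP=> /andP[yW /(nbr y yW)]; rewrite (negbTE xD).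
Qed.

(** A path through [core3] can use the three vertices of [K] as connectors between four pieces off
    [K], one of them the edge on [D]. Entering from [x] at a vertex off [K] gives nine vertices; the
    two cases are [w] in [D] and [w] outside it. *)
Lemma core3_nbr e S K D x w : symmetric e -> irreflexive e -> core3 e S K D ->
    8 <= #|S| -> x \notin S -> paths_le e (x |: S) 8 ->
  w \in S -> e x w -> w \in K.
Proof.
move=> e_sym e_irr [sK sD cK cD eE] S8 xS leS wS exw; apply/negPn/negP=> wK.
pose R := S :\: K :\: D.
have cR : 3 <= #|R|.
  have := cardsID K S; have := cardsID D (S :\: K).
  by rewrite (setIidPr sK) (setIidPr sD) cK cD -/R; move: S8; clear; lia.
have RE u : u \in R -> [/\ u \notin D, u \notin K & u \in S].
  by rewrite !inE => /and3P[].
have DE u : u \in D -> u \notin K /\ u \in S.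
  by move/(subsetP sD); rewrite inE => /andP[].
have eK u v : u \in S -> u \notin K -> v \in K -> e u v && e v u.
  move=> uS uK vK; have vS := subsetP sK v vK.
  have uv : u != v by apply: contraNneq uK => ->.
  by rewrite [e v u]e_sym andbb eE // vK orbT.
case: (uniq_seq_of_card (eq_leq (esym cK))) => -[|a [|b [|c [|? ?]]]] [uk ? kK] //.
have [aK bK cK'] : [/\ a \in K, b \in K & c \in K].
  by split; apply: kK; rewrite !inE eqxx ?orbT.
have no9 p us ds : sorted e (x :: p) ->
    perm_eq p (us ++ [:: a; b; c] ++ ds) -> uniq us -> uniq ds -> size p = 8 ->
    {subset us <= R} -> {subset ds <= D} -> False.
  move=> sp pp uu ud szp usR dsD.
  have pS : {subset p <= S}.
    move=> v; rewrite (perm_mem pp) !mem_cat => /or3P[/usR/RE[]//|/kK|/dsD/DE[]//].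
    exact: (subsetP sK).
  have : ipath e (x |: S) (x :: p).
    apply/and3P; split.
    - rewrite cons_uniq (perm_uniq pp) !cat_uniq has_cat negb_or uu uk ud andbT.
      rewrite -!andbA andTb; apply/and4P; split; first by apply: contra xS => /pS.
      + apply/hasPn=> v /kK vK; apply/negP=> /usR/RE[_].
        by rewrite vK.
      + apply/hasPn=> v /dsD vD; apply/negP=> /usR/RE[].
        by rewrite vD.
      apply/hasPn=> v /dsD/DE[vK _]; apply/negP=> /kK.
      by rewrite (negbTE vK).
    - by [].
    by apply/allP=> v; rewrite !inE => /predU1P[->|/pS->]; rewrite ?eqxx ?orbT.
  by move/leS; rewrite /= szp.
have [wD|wD] := boolP (w \in D).
  have /card_gt0P[f] : 0 < #|D :\ w| by move: (cardsD1 w D); rewrite wD cD add1n => -[<-].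
  rewrite !inE => /andP[fw fD]; have [fK fS] := DE f fD.
  case: (uniq_seq_of_card cR) => -[|u1 [|u2 [|u3 [|? ?]]]] [uu ? uR] //.
  have [u1R u2R u3R] : [/\ u1 \in R, u2 \in R & u3 \in R].
    by split; apply: uR; rewrite !inE eqxx ?orbT.
  have [[_ n1 s1] [_ n2 s2] [_ n3 s3]] := And3 (RE _ u1R) (RE _ u2R) (RE _ u3R).
  have ewf : e w f by rewrite eE // 1?eq_sym // wD fD !orbT.
  apply: (no9 [:: w; f; c; u3; b; u2; a; u1] [:: u1; u2; u3] [:: f; w]) => //.
  - rewrite /= exw ewf; have /andP[-> _] := eK f c fS fK cK'.
    have /andP[_ ->] := eK u3 c s3 n3 cK'; have /andP[-> _] := eK u3 b s3 n3 bK.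
    have /andP[_ ->] := eK u2 b s2 n2 bK; have /andP[-> _] := eK u2 a s2 n2 aK.
    by have /andP[_ ->] := eK u1 a s1 n1 aK.
  - by apply/permP=> P /=; do 8!move: (nat_of_bool (P _)) => ?; clear; lia.
  - by rewrite /= inE fw.
  by move=> v; rewrite !inE => /orP[]/eqP->.
have wR : w \in R by rewrite !inE wD wK.
have cRw : 2 <= #|R :\ w| by have := cardsD1 w R; rewrite wR; move: cR; clear; lia.
case: (uniq_seq_of_card cRw) => -[|u2 [|u3 [|? ?]]] [uu ? uR] //.
case: (uniq_seq_of_card (eq_leq (esym cD))) => -[|d [|f [|? ?]]] [ud ? dD] //.
have [dD' fD'] : d \in D /\ f \in D by split; apply: dD; rewrite !inE eqxx ?orbT.
have [[dK dS] [fK fS]] := (DE _ dD', DE _ fD').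
have [u2R u3R] : u2 \in R :\ w /\ u3 \in R :\ w.
  by split; apply: uR; rewrite !inE eqxx ?orbT.
move: (u2R) (u3R); rewrite !in_setD1 => /andP[u2w /RE[_ n2 s2]] /andP[u3w /RE[_ n3 s3]].
have edf : e d f.
  by rewrite eE ?dD' ?fD' ?orbT //; move: ud; rewrite /= inE andbT.
apply: (no9 [:: w; a; u2; b; u3; c; d; f] [:: w; u2; u3] [:: d; f]) => //.
- rewrite /= exw edf; have /andP[-> _] := eK w a wS wK aK.
  have /andP[_ ->] := eK u2 a s2 n2 aK; have /andP[-> _] := eK u2 b s2 n2 bK.
  have /andP[_ ->] := eK u3 b s3 n3 bK; have /andP[-> _] := eK u3 c s3 n3 cK'.
  by have /andP[_ ->] := eK d c dS dK cK'.
- by apply/permP=> P /=; do 8!move: (nat_of_bool (P _)) => ?; clear; lia.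
- by rewrite cons_uniq uu andbT !inE negb_or eq_sym u2w eq_sym u3w.
move=> v; rewrite inE => /predU1P[->//|/uR]; rewrite in_setD1.
by case/andP.
Qed.

(** Each deleted vertex has degree at most 3 and costs at most 6 in [vol], so the lower bound 6n -
    10 survives deletion down to 9 vertices, where it reads 44. *)
Lemma dense_conn_core3 e S : symmetric e -> irreflexive e -> conn e S ->
    paths_le e S 8 -> 10 <= #|S| -> 6 * #|S| <= vol e S + 10 ->
  exists K D, core3 e S K D.
Proof.
move=> e_sym e_irr cnS leS S10 volS; suff [[S9 _]|//] :
    (#|S| = 9 /\ exists x y, [/\ x \in S, y \in S, x != y, deg e S x <= 1
                              & deg e S y <= 1]) \/ exists K D, core3 e S K D.
  by rewrite S9 in S10.
have {S10} : 9 <= #|S| := ltnW S10.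
have [k] := ubnP #|S|; elim: k S cnS leS volS => // k IHk S cnS leS volS lt_k.
rewrite leq_eqVlt => /predU1P[/esym S9|S9].
  have : 44 <= vol e S by lia.
  by case/(dense9 e_sym e_irr cnS leS S9); [left|right].
have [x [xS degx cnSx]] := low_degree_end e_sym e_irr (m := 4) cnS leS (ltnW S9).
pose S' := S :\ x; have leS' : paths_le e S' 8 := paths_le_subset (subsetDl _ _) leS.
have cS := cardsD1 x S; rewrite xS -/S' in cS.
have vS := vol_setD1 e_sym e_irr xS; rewrite -/S' in vS.
have xS' : x \notin S' by rewrite !inE eqxx.
have defS : S = x |: S' by rewrite setD1K.
have degE' : deg e S' x = deg e S x.
  by rewrite defS !degE big_setU1 //= e_irr.
right; have [||//|[S'9 [y [z [yS zS yz degy degz]]]]|[K [D c3]]] := IHk S' cnSx leS'.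
- by lia.
- by lia.
- by lia.
- have vol46 : vol e S' <= 46 := vol_conn9 e_sym e_irr cnSx leS' S'9.
  have vol44 : 44 <= vol e S' by lia.
  have := two_leaves9 e_sym e_irr cnSx S'9 vol44 yS zS yz degy degz xS'.
  by rewrite -defS degE' => /(_ leS) le1; lia.
(* The upper bound for [S'] and the lower bound for [S] leave no slack, so [x] has exactly three
   neighbours, and these fill [K]. *)
have vol3 := core3_vol e_irr c3; have deg3 : deg e S' x = 3 by lia.
exists K, D; have [sK sD cK cD eE] := c3.
have nbr y : y \in S' -> e x y = (y \in K).
  move=> yS'; have /eqP/setP/(_ y) : [set z in S' | e x z] == K.
    rewrite eqEcard -/(deg e S' x) deg3 cK leqnn andbT.
    apply/subsetP=> z; rewrite inE => /andP[zS' exz].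
    by apply: (core3_nbr e_sym e_irr c3 _ xS' _ zS' exz); [lia | rewrite -defS].
  by rewrite inE yS'.
have sS : S' \subset S := subsetDl _ _.
have xK : x \in K = false by apply: contraNF xS' => /(subsetP sK).
have xD : x \in D = false.
  by apply: contraNF xS' => /(subsetP sD); rewrite inE => /andP[].
split=> //; first exact: subset_trans sK sS.
  exact: subset_trans sD (setSD _ sS).
move=> y z yS zS yz; have [yx|yx] := eqVneq y x; have [zx|zx] := eqVneq z x.
- by rewrite yx zx eqxx in yz.
- by rewrite yx xK xD nbr ?orbF // !inE zx.
- by rewrite zx xK xD e_sym nbr ?andbF ?orbF // !inE yx.
by apply: eE; rewrite ?inE ?yx ?zx.
Qed.

End Extremal.

(** * Bipartite graphs without long paths *)

Section Bipartite.
Variables (T : finType) (e : rel T) (side : pred T).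
Hypotheses (e_sym : symmetric e) (e_irr : irreflexive e).
Hypothesis e_side : forall x y, e x y -> side x != side y.
Implicit Types (S A C : {set T}) (x y z : T) (p q s : seq T) (c : bool).

Definition part c S := [set x in S | side x == c].

Lemma card_part_D1 c S x : x \in S ->
  #|part c S| = (side x == c) + #|part c (S :\ x)|.
Proof.
move=> xS; rewrite (cardsD1 x) inE xS /=; congr (_ + _).
by apply: eq_card => y; rewrite !inE andbA.
Qed.

Lemma card_part_D c S A : A \subset S ->
  #|part c S| = #|part c A| + #|part c (S :\: A)|.
Proof.
move=> sAS; rewrite -(cardsID A (part c S)); congr (_ + _).
  apply: eq_card => y; rewrite !inE; case yA: (y \in A); rewrite ?andbF //.
  by rewrite (subsetP sAS y yA) andbT.
by apply: eq_card => y; rewrite !inE andbA.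
Qed.

Lemma deg_part_le S x : deg e S x <= #|part (~~ side x) S|.
Proof.
apply/subset_leq_card/subsetP=> y; rewrite !inE => /andP[-> /e_side].
by case: (side x) (side y) => [] [].
Qed.

Lemma vol_bip_le S : vol e S <= 2 * (#|part true S| * #|part false S|).
Proof.
have bound c : \sum_(x in part c S) deg e S x <= #|part c S| * #|part (~~ c) S|.
  rewrite -sum_nat_const; apply: leq_sum => x; rewrite inE => /andP[_ /eqP<-].
  exact: deg_part_le.
have -> : vol e S = \sum_(x in part true S) deg e S x + \sum_(x in part false S) deg e S x.
  rewrite /vol (bigID side) /=; congr (_ + _); apply: eq_bigl => x; rewrite inE.
    by rewrite eqb_id.
  by rewrite eqbF_neg.
by rewrite mul2n -addnn; apply: leq_add (bound true) _; rewrite mulnC; apply: bound false.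
Qed.

Lemma path_side x s : path e x s -> path (fun y z => side y != side z) x s.
Proof. by apply: sub_path; apply: e_side. Qed.

Lemma side_last x s : path e x s -> side (last x s) = side x (+) odd (size s).
Proof.
elim: s x => [|y s IHs] x /=; first by rewrite addbF.
case/andP=> /e_side sxy /IHs->; case: (side x) (side y) sxy => [] [] //= _.
by rewrite negbK.
Qed.

(** The ends lie on opposite sides, so crossing pairs can occur at only [n.+1] of the consecutive
    pairs of the path; a larger degree sum forces one. *)
Lemma even_longest S x p n : longest e S (x :: p) -> size p = n.*2.+1 ->
    ~~ (deg e S x + deg e S (last x p) <= n.+1) ->
  exists s, [/\ cycle e s, uniq s & perm_eq s (x :: p)].
Proof.
move=> lp sz; have [ip _] := lp; have /and3P[_ ep _] := ip.
rewrite (deg_longest e_sym e_irr lp) (deg_longest_last e_sym e_irr lp) addnC => ns.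
apply: (crossing_cycle e_sym ip); apply: contra ns => crs.
have sl : side (last x p) = ~~ side x.
  by rewrite side_last // sz /= odd_double addbT.
apply: (count_shift_alt (side := side) (c := side x)) sz crs (path_side ep) _ _ erefl.
  by move=> y /e_side; rewrite sl; case: (side x) (side y) => [] [].
by move=> y /e_side; case: (side x) (side y) => [] [].
Qed.

Lemma count_side_cycle n s c : cycle e s -> size s = n.*2 ->
  count (fun x => side x == c) s = n.
Proof.
case: s => [|x s]; first by case: n.
rewrite [cycle _ _]/= rcons_path => /andP[ps _] sz.
have cn : count (fun y => side y == ~~ side x) (x :: s) = n.
  by rewrite (count_alt (path_side ps) erefl) -[(size s).+1]/(size (x :: s)) sz doubleK.
have [->//|cx] := eqVneq c (~~ side x).
have {cx}-> : c = side x by case: c (side x) cx => [] [].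
have := count_predC (fun y => side y == ~~ side x) (x :: s).
rewrite cn sz -addnn => /addnI<-; apply: eq_count => y /=.
by case: (side x) (side y) => [] [].
Qed.

(* Every vertex off a cycle of length 2m - 2 hangs directly from it, and no two
   vertices hang from consecutive vertices of the cycle. *)
Lemma low_degree_off_cycle C m s : 3 <= m -> conn e C -> paths_le e C m.*2.-1 ->
    m <= #|part true C| -> m <= #|part false C| ->
    cycle e s -> uniq s -> {subset s <= C} -> size s = m.-1.*2 ->
  exists2 x, x \in C & deg e C x <= m - 3.
Proof.
move=> m3 cnC leC leX leY cs us sC szs.
have m2 : m.*2.-1 < m.-1.*2.+2 by move: m3; clear; lia.
have no_tail z u q : ipath e C (u :: q) -> perm_eq q s -> z \in C ->
    z \notin s -> z != u -> e z u -> False.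
  move=> /and3P[uq eq_ Cq] pq zC zs zu ezu.
  have /leC : ipath e C (z :: u :: q).
    apply/and3P; split; last by rewrite /= zC.
      by rewrite cons_uniq uq andbT inE negb_or zu (perm_mem pq).
    by rewrite /= ezu.
  by rewrite /= (perm_size pq) szs leqNgt m2.
have s0 : exists x, x \in s.
  case: (s) szs => [|x s'] szs; last by exists x; rewrite inE eqxx.
  by move: szs m3; clear => /=; lia.
(* A vertex at distance two from the cycle would prolong the opened cycle to 2m vertices, so [N] is
   closed. *)
pose N := [set v in C | (v \in s) || has (e v) s].
have NC : N = C.
  apply: cnC; last first.
    by have [x xs] := s0; apply/set0Pn; exists x; rewrite inE sC ?xs.
  apply/closed_inP; split=> [|v z]; first by apply/subsetP=> v; rewrite inE => /andP[].
  rewrite !inE => /andP[vC vN] zC evz; rewrite zC /=.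
  have [//|zs] := boolP (z \in s); have [vs|vs] := boolP (v \in s).
    by apply/hasP; exists v; rewrite // e_sym.
  rewrite (negbTE vs) /= in vN; have /hasP[t ts evt] := vN.
  have [q iq pq] := ipath_cycle_cons cs us sC ts vC vs evt.
  case: (no_tail z v q) => //; last by rewrite e_sym.
  by apply: contraTneq evz => ->; rewrite e_irr.
(* The cycle uses only m - 1 vertices of each side. *)
have off c : exists2 v, v \in C & (v \notin s) && (side v == c).
  apply/exists_inP; apply: contraT => /exists_inPn none.
  have : #|part c C| <= count (fun x => side x == c) s.
    rewrite -size_filter -(card_uniqP (filter_uniq _ us)).
    apply/subset_leq_card/subsetP=> v; rewrite inE mem_filter => /andP[vC vc].
    by rewrite vc; have := none v vC; rewrite vc andbT negbK.
  rewrite (count_side_cycle _ cs szs) leqNgt => /negP[].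
  by case: c {none}; move: m3 leX leY; clear; lia.
have hang v : v \in C -> v \notin s -> exists2 t, t \in s & e v t.
  by rewrite -{1}NC inE => /andP[_ /orP[->//|/hasP]].
have [[u uC /andP[us' /eqP su]] [w wC /andP[ws /eqP sw]]] := (off true, off false).
exists u => //.
have [x xs ewx] := hang w wC ws; have [r ur eur] := hang u uC us'.
have [i [t [def_s pt elx]]] := cycle_walk cs xs.
have ps : perm_eq (x :: t) s by rewrite -def_s perm_rot.
have nbr y : y \in C -> e u y -> y \in x :: t.
  move=> yC euy; rewrite (perm_mem ps); apply/negPn/negP=> ys.
  have [q iq pq] := ipath_cycle_cons cs us sC ur uC us' eur.
  apply: (no_tail y u q) => //; last by rewrite e_sym.
  by apply: contraTneq euy => ->; rewrite e_irr.
have xtC : {subset x :: t <= C} by move=> y; rewrite (perm_mem ps); apply: sC.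
have uxt : uniq (x :: t) by rewrite (perm_uniq ps).
(* If [u] were adjacent to a cycle neighbour [y] of [x], the path from [w] to [x], around the cycle
   to [y], then to [u] would have 2m vertices. So [u] misses two of the m - 1 cycle vertices on the
   opposite side, whence m - 3. *)
have no2 q y : perm_eq q t -> walk e x (x :: q) y -> ~~ e y u.
  move=> pq wq; apply/negP=> eyu.
  have pq' : perm_eq (x :: q) s by rewrite -(permPr ps) perm_cons.
  have uw : u != w by apply/eqP=> uw; rewrite uw sw in su.
  have /leC : ipath e C (w :: rcons (x :: q) u).
    apply/and3P; split.
    - rewrite cons_uniq rcons_uniq (perm_uniq pq') us andbT mem_rcons inE.
      by rewrite !(perm_mem pq') us' eq_sym (negbTE uw) andbT.
    - exact: walk_sorted (walk_cons ewx (walk_rcons wq eyu)).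
    apply/allP=> v; rewrite inE mem_rcons inE (perm_mem pq').
    by case/or3P=> [/eqP->|/eqP->|/sC].
  by rewrite /= size_rcons -[(size q).+1]/(size (x :: q)) (perm_size pq') szs leqNgt m2.
rewrite (deg_count uxt xtC nbr).
have sx : side x = true.
  by have := e_side ewx; rewrite sw; case: (side x).
have eux : e u x = false by apply/negP=> /e_side; rewrite su sx.
have szt : (size t).+1 = m.-1.*2 by rewrite -szs -(perm_size ps).
case: t {xtC uxt nbr} => [|a t] in def_s pt elx ps no2 szt *.
  by move: szt; clear => /=; lia.
have {no2} [nl nh] : ~~ e u (last a t) /\ ~~ e u a.
  have wt := sorted_walk (pt : sorted e (x :: a :: t)).
  split; rewrite e_sym; first exact: no2 (perm_refl _) wt.
  apply: (no2 (rev (a :: t))); first by rewrite perm_rev.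
  have wat : walk e a (a :: t) (last a t).
    by apply: sorted_walk; case/andP: pt.
  by apply: walk_cons (walk_rev e_sym wat); rewrite e_sym.
case: (lastP t) => [|t' b] in pt szt nl *.
  by rewrite /= eux (negbTE nh).
rewrite last_rcons in nl; rewrite -cats1 /= eux (negbTE nh) count_cat /= (negbTE nl).
rewrite !addn0 !add0n; case: t' => [//|d t'] in pt szt *.
move: pt; rewrite /= => /and3P[exa ead]; rewrite rcons_path => /andP[pd _].
have sd : side d = true.
  by have := e_side exa; have := e_side ead; rewrite sx; case: (side a) (side d) => [] [].
rewrite -[X in X <= _]/(count (e u) (d :: t')).
apply: leq_trans (sub_count (a2 := fun y => side y == ~~ true) _ _) _.
  by move=> y /e_side; rewrite su; case: (side y).
rewrite (count_alt (path_side pd) sd); move: szt m3; rewrite /= size_rcons.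
by clear; lia.
Qed.

(** The end of a longest path has its neighbours at odd distance along the path. Distance 2m - 3
    would close a cycle of length 2m - 2, so only 1, 3, ..., 2m - 5 remain: degree at most m - 2.
    Both hypotheses pass to the graph without this end. *)
Lemma vol_no_cycle C m : 2 <= m -> paths_le e C m.*2.-1 ->
    (forall s, cycle e s -> uniq s -> {subset s <= C} -> size s <> m.-1.*2) ->
  vol e C <= 2 * ((m - 2) * #|C|).
Proof.
move=> m2; have [k] := ubnP #|C|; elim: k C => // k IHk C lt_k leC nocyc.
have [->|[x0 x0C]] := set_0Vmem C; first by rewrite /vol big_set0.
have [x [p lp]] := longest_path e x0C; rewrite -/(longest e C (x :: p)) in lp.
have [ip _] := lp; have /and3P[up ep /allP Cp] := ip.
have xC : x \in C by apply: Cp; rewrite inE eqxx.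
have degx : deg e C x <= m - 2.
  rewrite (deg_longest e_sym e_irr lp) /= e_irr add0n.
  rewrite -(cat_take_drop (m - 2).*2 p) count_cat.
  have le1 : count (e x) (take (m - 2).*2 p) <= m - 2.
    have pt : path e x (take (m - 2).*2 p).
      move: (ep : path e x p); rewrite -{1}(cat_take_drop (m - 2).*2 p) cat_path.
      by case/andP.
    have : count (fun y => side y == ~~ side x) (x :: take (m - 2).*2 p) <= m - 2.
      rewrite (count_alt (path_side pt) erefl) size_take_min.
      by clear; lia.
    apply: leq_trans; rewrite [count _ (x :: _)]/= -[X in X <= _]add0n leq_add //.
    apply: sub_count => y /e_side.
    by case: (side x) (side y) => [] [].
  suff -> : count (e x) (drop (m - 2).*2 p) = 0 by rewrite addn0.
  have : size (drop (m - 2).*2 p) <= 2.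
    by have := leC _ ip; rewrite size_drop /=; move: m2; clear; lia.
  case def_d: (drop _ p) => [//|z d] szd.
  have sz_t : size (take (m - 2).*2 p) = (m - 2).*2.
    apply: size_takel; rewrite leqNgt; apply/negP=> lt_p.
    by rewrite drop_oversize // ltnW in def_d.
  have def_p : p = take (m - 2).*2 p ++ z :: d by rewrite -def_d cat_take_drop.
  have /andP[pz pd] : path e x (rcons (take (m - 2).*2 p) z) && path e z d.
    move: (ep : path e x p); rewrite {1}def_p cat_path rcons_path /=.
    by rewrite -andbA.
  have nz : e x z = false.
    apply/negP=> exz; apply: (nocyc (x :: rcons (take (m - 2).*2 p) z)).
    - by rewrite /= rcons_path pz last_rcons e_sym.
    - move: up; rewrite {1}def_p -cat_rcons -cat_cons cat_uniq.
      by case/andP.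
    - move=> y yp; apply: Cp.
      by rewrite {1}def_p -cat_rcons -cat_cons mem_cat yp.
    by rewrite /= size_rcons sz_t; move: m2; clear; lia.
  have sz : side z = ~~ side x.
    have := side_last pz; rewrite last_rcons size_rcons sz_t /= odd_double.
    by rewrite addbT.
  case: d szd pd {def_d def_p} => [|t [|//]] _ /=; first by rewrite nz.
  case/andP=> /e_side szt _; rewrite nz.
  have -> // : e x t = false.
  by apply/negP=> /e_side; move: szt; rewrite sz; case: (side x) (side t) => [] [].
rewrite (vol_setD1 e_sym e_irr xC); have cC := cardsD1 x C; rewrite xC in cC.
rewrite cC add1n mulnS mulnDr addnC; apply: leq_add; first by rewrite leq_mul2l.
apply: IHk (paths_le_subset (subsetDl _ _) leC) _; first by move: lt_k; rewrite cC.
by move=> s cs us sC; apply: nocyc => // y /sC; rewrite inE => /andP[].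
Qed.

(** A longest path on 2m vertices gives one of the first two cases, according to whether it closes
    into a spanning cycle. A shorter one gives the last two, according to whether there is a cycle
    of length 2m - 2. *)
Lemma component_cases C m : 3 <= m -> conn e C -> paths_le e C m.*2 ->
    m <= #|part true C| -> m <= #|part false C| ->
  [\/ #|C| = m.*2,
      exists x y, [/\ x \in C, y \in C, side x != side y & deg e C x + deg e C y <= m],
      exists2 x, x \in C & deg e C x <= m - 3
    | vol e C <= 2 * ((m - 2) * #|C|)].
Proof.
move=> m3 cnC leC leX leY; have m_gt0 := ltn_trans (isT : 0 < 2) m3.
have [x0 x0C] : exists x, x \in C.
  have /card_gt0P[x] : 0 < #|part true C| by apply: leq_trans leX.
  by rewrite inE => /andP[xC _]; exists x.
have [x [p lp]] := longest_path e x0C; rewrite -/(longest e C (x :: p)) in lp.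
have [ip maxp] := lp; have /and3P[up ep /allP Cp] := ip.
have := leC _ ip; rewrite leq_eqVlt => /predU1P[sz|lt_p].
  have szp : size p = m.-1.*2.+1 by move: sz m_gt0; rewrite /=; clear; lia.
  have [le_m|/(even_longest lp szp)[s [cs us pcs]]] :=
    boolP (deg e C x + deg e C (last x p) <= m.-1.+1).
    apply: Or42; exists x, (last x p); split.
    - by apply: Cp; rewrite inE eqxx.
    - by apply: Cp; apply: mem_last.
    - by rewrite (side_last ep) szp /= odd_double addbT; case: (side x).
    by rewrite prednK in le_m.
  apply: Or41; have sC : {subset s <= C} by move=> y; rewrite (perm_mem pcs); apply: Cp.
  have szs := perm_size pcs; rewrite sz in szs.
  have s0 : s != [::] by case: (s) szs m_gt0 => //=; clear; lia.
  rewrite (eq_card (conn_cycle e_sym cnC leC cs us sC _ s0)) ?szs //.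
  by rewrite (card_uniqP us).
have leC' : paths_le e C m.*2.-1.
  by move=> q /maxp le_q; rewrite -ltnS prednK ?double_gt0 //; apply: leq_ltn_trans lt_p.
have [/existsP[s /and3P[cs us /allP sC]]|/existsPn none] :=
  boolP [exists s : m.-1.*2.-tuple T, [&& cycle e s, uniq s & all [in C] s]].
  by apply: Or43; apply: low_degree_off_cycle cs us sC (size_tuple s).
apply: Or44; apply: vol_no_cycle leC' _ => [|s cs us sC szs]; first exact: ltnW.
have /negP[] := none (tcast szs (in_tuple s)).
by rewrite val_tcast /= cs us; apply/allP.
Qed.

End Bipartite.

(* A closed form for the recursion given by component_cases, valid only in the
   ranges that bip_bound_ok tests.  The term (m - 1)q + p - (m - 1) is attained by
   K_{m-1,q} with the other p - m + 1 vertices hanging from one vertex. *)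
Definition bip_bound m p q :=
  if minn p q < m then p * q
  else maxn (maxn (m * minn p q) ((m - 2) * (p + q)))
            (maxn (m.-1 * q + p - m.-1) (m.-1 * p + q - m.-1)).

(** The inequalities needed by the induction, as a boolean that evaluates for concrete arguments:
    splitting off a component with parts [a] and [b], deleting two opposite vertices of degree sum
    at most [m], deleting one vertex of degree at most [m - 3]. *)
Definition bip_bound_ok m P Q :=
  let F := bip_bound m in
  all (fun p => all (fun q =>
    all (fun a => all (fun b =>
      let r := F (p - a) (q - b) in
      if minn a b < m then a * b + r <= F p q
      else ((m - 2) * (a + b) + r <= F p q) &&
           ((a == m) && (b == m) ==> (a * b + r <= F p q)))
      (iota 0 q.+1)) (iota 0 p.+1) &&
    ((m <= p) && (m <= q) ==>
      [&& F p.-1 q.-1 + m <= F p q, F p.-1 q + (m - 3) <= F p q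
        & F p q.-1 + (m - 3) <= F p q]))
    (iota 0 Q.+1)) (iota 0 P.+1).

Lemma bip_bound_okP m P Q p q : bip_bound_ok m P Q -> p <= P -> q <= Q ->
  [/\ forall a b, a <= p -> b <= q -> (minn a b < m) || (a == m) && (b == m) ->
        a * b + bip_bound m (p - a) (q - b) <= bip_bound m p q,
      forall a b, a <= p -> b <= q -> m <= minn a b ->
        (m - 2) * (a + b) + bip_bound m (p - a) (q - b) <= bip_bound m p q
    & m <= p -> m <= q ->
      [/\ bip_bound m p.-1 q.-1 + m <= bip_bound m p q,
          bip_bound m p.-1 q + (m - 3) <= bip_bound m p q
        & bip_bound m p q.-1 + (m - 3) <= bip_bound m p q]].
Proof.
move=> /allP okm le_p le_q.
have pP : p \in iota 0 P.+1 by rewrite mem_iota.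
have qQ : q \in iota 0 Q.+1 by rewrite mem_iota.
have /andP[/allP okab ok1] := allP (okm p pP) q qQ.
have okab' a b : a <= p -> b <= q ->
    if minn a b < m then a * b + bip_bound m (p - a) (q - b) <= bip_bound m p q
    else ((m - 2) * (a + b) + bip_bound m (p - a) (q - b) <= bip_bound m p q) &&
         ((a == m) && (b == m) ==>
            (a * b + bip_bound m (p - a) (q - b) <= bip_bound m p q)).
  move=> le_a le_b; have ap : a \in iota 0 p.+1 by rewrite mem_iota.
  by apply: (allP (okab a ap)); rewrite mem_iota.
split=> [a b le_a le_b|a b le_a le_b|mp mq].
- have := okab' a b le_a le_b; case: (minn a b < m) => [//|] /andP[_ /implyP h].
  by rewrite orFb; apply: h.
- by move=> ge_m; have := okab' a b le_a le_b; rewrite ltnNge ge_m => /andP[].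
by move: ok1; rewrite mp mq => /and3P.
Qed.

(** Induction on [S] through one component [C]: if a part of [C] is smaller than [m], or both equal
    [m], the complete bipartite bound is used; otherwise [component_cases] decides between deletion
    and splitting. *)
Lemma vol_bip_bound (T : finType) (e : rel T) (side : pred T) m P Q (S : {set T}) :
    symmetric e -> irreflexive e -> (forall x y, e x y -> side x != side y) ->
    3 <= m -> bip_bound_ok m P Q -> paths_le e S m.*2 ->
    #|part side true S| <= P -> #|part side false S| <= Q ->
  vol e S <= 2 * bip_bound m #|part side true S| #|part side false S|.
Proof.
move=> e_sym e_irr e_side m3 okm; have [k] := ubnP #|S|.
elim: k S => // k IHk S lt_k leS leP leQ.
have [->|[x0 x0S]] := set_0Vmem S; first by rewrite /vol big_set0.
have [C [clC cnC x0C]] := component e_sym x0S; have [sCS _] := closed_inP _ _ _ clC.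
have [okC okN ok1] := bip_bound_okP okm leP leQ.
have [pX pY] := (card_part_D side true sCS, card_part_D side false sCS).
have le_pX : #|part side true C| <= #|part side true S| by rewrite pX leq_addr.
have le_pY : #|part side false C| <= #|part side false S| by rewrite pY leq_addr.
have leC := paths_le_subset sCS leS.
have IHC : vol e (S :\: C) <= 2 * bip_bound m (#|part side true S| - #|part side true C|)
                                          (#|part side false S| - #|part side false C|).
  rewrite pX pY !addKn; apply: IHk.
  - rewrite -ltnS; apply: leq_trans lt_k; rewrite ltnS proper_card // properE subsetDl.
    by apply/subsetPn; exists x0; rewrite // inE x0C.
  - exact: paths_le_subset (subsetDl _ _) leS.
  - by apply: leq_trans leP; rewrite pX leq_addl.
  by apply: leq_trans leQ; rewrite pY leq_addl.
have drop1 x : x \in S -> vol e (S :\ x) <= 2 * bip_bound m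
    (#|part side true S| - (side x == true)) (#|part side false S| - (side x == false)).
  move=> xS; rewrite !(card_part_D1 side _ xS) !addKn; apply: IHk.
  - by move: lt_k; rewrite (cardsD1 x S) xS.
  - exact: paths_le_subset (subsetDl _ _) leS.
  - by apply: leq_trans leP; rewrite (card_part_D1 side _ xS) leq_addl.
  by apply: leq_trans leQ; rewrite (card_part_D1 side _ xS) leq_addl.
have small : (minn #|part side true C| #|part side false C| < m)
    || (#|part side true C| == m) && (#|part side false C| == m) ->
    vol e S <= 2 * bip_bound m #|part side true S| #|part side false S|.
  move=> smC; rewrite (vol_closed e_sym clC).
  apply: leq_trans (leq_mul (leqnn 2) (okC _ _ le_pX le_pY smC)).
  by rewrite mulnDr leq_add // vol_bip_le.
have [lt_m|] := ltnP (minn #|part side true C| #|part side false C|) m.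
  by apply: small; rewrite lt_m.
rewrite leq_min => /andP[geX geY].
have [ge_pX ge_pY] := (leq_trans geX le_pX, leq_trans geY le_pY).
have [okp okx oky] := ok1 ge_pX ge_pY.
have subS x : x \in C -> x \in S by apply: (subsetP sCS).
have cC : #|C| = #|part side true C| + #|part side false C|.
  rewrite -(cardsID [set x | side x] C); congr (_ + _); apply: eq_card => y.
    by rewrite !inE eqb_id.
  by rewrite !inE eqbF_neg andbC.
have [c2m|[x [y [xC yC sxy le_xy]]]|[x xC le_x]|volC] :=
  component_cases e_sym e_irr e_side m3 cnC leC geX geY.
- apply: small; apply/orP; right; move: c2m geX geY; rewrite cC -addnn.
  by clear; lia.
- have [xS yS] := (subS x xC, subS y yC).
  have ySx : y \in S :\ x.
    by rewrite !inE yS andbT; apply: contraNneq sxy => ->.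
  rewrite (vol_setD1 e_sym e_irr xS) (vol_setD1 e_sym e_irr ySx).
  have le_xS : deg e S x + deg e (S :\ x) y <= m.
    apply: leq_trans le_xy; rewrite (deg_component clC xC) leq_add2l.
    by rewrite -(deg_component clC yC) deg_subset // subsetDl.
  have : vol e ((S :\ x) :\ y)
         <= 2 * bip_bound m #|part side true S|.-1 #|part side false S|.-1.
    have -> : #|part side true S|.-1 = #|part side true ((S :\ x) :\ y)|.
      rewrite (card_part_D1 side _ xS) (card_part_D1 side _ ySx).
      by case: (side x) (side y) sxy => [] [].
    have -> : #|part side false S|.-1 = #|part side false ((S :\ x) :\ y)|.
      rewrite (card_part_D1 side _ xS) (card_part_D1 side _ ySx).
      by case: (side x) (side y) sxy => [] [].
    have sub : (S :\ x) :\ y \subset S := subset_trans (subsetDl _ _) (subsetDl _ _).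
    apply: IHk; last 2 first.
    - by apply: leq_trans leP; rewrite (card_part_D _ _ sub) leq_addr.
    - by apply: leq_trans leQ; rewrite (card_part_D _ _ sub) leq_addr.
    - rewrite -ltnS; apply: leq_trans lt_k; rewrite ltnS (cardsD1 x S) xS.
      by rewrite ltnS subset_leq_card // subsetDl.
    exact: paths_le_subset sub leS.
  by move: okp le_xS; clear; lia.
- have xS := subS x xC; have := drop1 x xS; rewrite (vol_setD1 e_sym e_irr xS).
  rewrite (deg_component clC xC); case: (side x); rewrite /= subn0 subn1.
    by move: okx le_x; clear; lia.
  by move: oky le_x; clear; lia.
rewrite (vol_closed e_sym clC).
have geC : m <= minn #|part side true C| #|part side false C| by rewrite leq_min geX.
apply: leq_trans (leq_mul (leqnn 2) (okN _ _ le_pX le_pY geC)).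
by rewrite mulnDr leq_add // -cC.
Qed.

(** * Three colours *)

Section ThreeColours.
Variables (T : finType) (E : 'I_3 -> rel T).
Hypotheses (E_sym : forall i, symmetric (E i)) (E_irr : forall i, irreflexive (E i)).
Hypothesis E_sum : forall x y, x != y -> \sum_(i < 3) E i x y = 1.
Implicit Types (S A C : {set T}) (x y : T).

Lemma sum_vol S : \sum_(i < 3) vol (E i) S = #|S| * #|S|.-1.
Proof.
rewrite /vol exchange_big /= -sum_nat_const; apply: eq_bigr => x xS.
under eq_bigr do rewrite degE; rewrite exchange_big /= (bigD1 x xS) /=.
rewrite big1 ?add0n; last by move=> i _; rewrite E_irr.
under eq_bigr => y /andP[_ yx] do rewrite E_sum 1?eq_sym //.
rewrite sum1_card [#|S|](cardsD1 x) xS /=; apply: eq_card => y.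
by rewrite !inE andbC.
Qed.

Lemma pigeonhole3 (f : 'I_3 -> nat) n : 3 * n < \sum_(i < 3) f i ->
  exists i, n < f i.
Proof.
move=> lt_n; have [/existsP//|/existsPn none] := boolP [exists i, n < f i].
suff : \sum_(i < 3) f i <= 3 * n by rewrite leqNgt lt_n.
rewrite -[X in X * n](card_ord 3) -sum_nat_const; apply: leq_sum => i _.
by rewrite leqNgt none.
Qed.

Definition crossing A (i : 'I_3) : rel T :=
  fun x y => E i x y && ((x \in A) != (y \in A)).

Lemma sum_vol_crossing A :
  \sum_(i < 3) vol (crossing A i) setT = 2 * (#|A| * #|~: A|).
Proof.
have cr x y : \sum_(i < 3) crossing A i x y = ((x \in A) != (y \in A)).
  rewrite /crossing; case: eqVneq => [_|nxy] /=.
    by rewrite big1 // => i _; rewrite andbF.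
  under eq_bigr do rewrite andbT.
  by rewrite E_sum //; apply: contraNneq nxy => ->.
rewrite /vol exchange_big /= (bigID (mem A)) /=.
rewrite (eq_bigr (fun=> #|~: A|)); last first.
  move=> x /andP[_ xA]; under eq_bigr do rewrite degE.
  rewrite exchange_big /= -sum1_card [RHS]big_mkcond [LHS]big_mkcond /=.
  by apply: eq_bigr => y _; rewrite cr !inE xA; case: (y \in A).
rewrite [X in _ + X](eq_bigr (fun=> #|A|)); last first.
  move=> x /andP[_ xA]; under eq_bigr do rewrite degE.
  rewrite exchange_big /= -sum1_card [RHS]big_mkcond [LHS]big_mkcond /=.
  by apply: eq_bigr => y _; rewrite cr !inE (negbTE xA); case: (y \in A).
rewrite (eq_bigl (mem A)); last by move=> x; rewrite inE.
rewrite [X in _ + X](eq_bigl (mem (~: A))); last by move=> x; rewrite !inE.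
by rewrite !sum_nat_const mul2n -addnn [X in _ + X]mulnC.
Qed.

(** Colour [i] has no edge across a closed [A], so two colours share the [#|A| * #|~: A|] crossing
    edges, each with at most [bip_bound] of them. *)
Lemma no_closed_split m P Q i A : 3 <= m -> bip_bound_ok m P Q ->
    (forall j, paths_le (E j) setT m.*2) -> closed_in (E i) setT A ->
    #|A| <= P -> #|~: A| <= Q -> 2 * bip_bound m #|A| #|~: A| < #|A| * #|~: A| ->
  False.
Proof.
move=> m3 okm leE clA leP leQ ltF.
have vol0 : vol (crossing A i) setT = 0.
  apply: big1 => x _; rewrite degE; apply: big1 => y _; apply/eqP; rewrite eqb0.
  have [_ cl] := closed_inP _ _ _ clA.
  apply/negP=> /andP[exy]; have eyx : E i y x by rewrite E_sym.
  have [xA|xA] := boolP (x \in A); first by rewrite (cl x y) // inE.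
  by have [yA|//] := boolP (y \in A); rewrite (cl y x) ?inE in xA.
have volj j : vol (crossing A j) setT <= 2 * bip_bound m #|A| #|~: A|.
  have sym : symmetric (crossing A j).
    by move=> x y; rewrite /crossing E_sym eq_sym.
  have irr : irreflexive (crossing A j) by move=> x; rewrite /crossing E_irr.
  have alt x y : crossing A j x y -> (x \in A) != (y \in A) by case/andP.
  have leX : paths_le (crossing A j) setT m.*2.
    move=> p /and3P[up sp Sp]; apply: (leE j); apply/and3P; split=> //.
    by apply: sub_sorted sp => x y /andP[].
  have pA : part (mem A) true setT = A.
    by apply/setP=> x; rewrite !inE /= eqb_id.
  have pB : part (mem A) false setT = ~: A.
    by apply/setP=> x; rewrite !inE /= eqbF_neg.
  have := vol_bip_bound sym irr alt m3 okm leX.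
  by rewrite pA pB; apply.
have := sum_vol_crossing A; rewrite (bigD1 i) //= vol0 add0n => sumE.
have le_sum : \sum_(j < 3 | j != i) vol (crossing A j) setT <=
       2 * (2 * bip_bound m #|A| #|~: A|).
  have c2 : #|[pred j | j != i]| = 2 by rewrite (cardC1 i) card_ord.
  by rewrite -[X in X * _]c2 -sum_nat_const; apply: leq_sum => j _.
by have := leq_trans (eq_leq (esym sumE)) le_sum; move: ltF; clear; lia.
Qed.

End ThreeColours.

(** * Upper bounds on 13 and 17 vertices *)

Section UpperBounds.
Variables (T : finType) (E : 'I_3 -> rel T).
Hypotheses (E_sym : forall i, symmetric (E i)) (E_irr : forall i, irreflexive (E i)).
Hypothesis E_sum : forall x y, x != y -> \sum_(i < 3) E i x y = 1.
Implicit Types (S A C : {set T}) (x y : T).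

(** Passing to the complement exchanges 2m - 1 with 2m + 2 and 2m with 2m + 1, so two numerical
    conditions cover four sizes. *)
Lemma no_small_closed m i C : 3 <= m -> bip_bound_ok m m.*2 m.*2.+2 ->
    2 * bip_bound m m.*2.-1 m.*2.+2 < m.*2.-1 * m.*2.+2 ->
    2 * bip_bound m m.*2 m.*2.+1 < m.*2 * m.*2.+1 ->
    (forall j, paths_le (E j) setT m.*2) -> #|T| = (m.*2).*2.+1 ->
    closed_in (E i) setT C -> m.*2.-1 <= #|C| <= m.*2.+2 ->
  False.
Proof.
move=> m3 okm lt1 lt2 leE cT clC /andP[geC leC].
have cC' := cardsC C; rewrite cT in cC'.
have clC' : closed_in (E i) setT (~: C) by rewrite -setTD closed_inD.
have split := no_closed_split E_sym E_irr E_sum m3 okm leE.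
have [c1|[c1|[c1|c1]]] :
    #|C| = m.*2.-1 \/ #|C| = m.*2 \/ #|C| = m.*2.+1 \/ #|C| = m.*2.+2.
- by move: geC leC m3; clear; lia.
- have c2 : #|~: C| = m.*2.+2 by move: cC' c1 m3; clear; lia.
  by apply: (split _ _ clC); rewrite ?c1 ?c2 ?leq_pred.
- have c2 : #|~: C| = m.*2.+1 by move: cC' c1 m3; clear; lia.
  by apply: (split _ _ clC); rewrite ?c1 ?c2.
- have c2 : #|~: C| = m.*2 by move: cC' c1 m3; clear; lia.
  by apply: (split _ _ clC'); rewrite ?setCK ?c1 ?c2.
have c2 : #|~: C| = m.*2.-1 by move: cC' c1 m3; clear; lia.
by apply: (split _ _ clC'); rewrite ?setCK ?c1 ?c2 ?leq_pred.
Qed.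

Lemma long_path13 : #|T| = 13 -> (forall i, paths_le (E i) setT 6) -> False.
Proof.
move=> cT leE; have [i] : exists i, 51 < vol (E i) setT.
  by apply: pigeonhole3; rewrite (sum_vol E_irr E_sum) cardsT cT.
apply/negP; rewrite -leqNgt.
have [[C [clC cnC C4]]|degs] :=
  big_component_or_deg (E_sym i) (E_irr i) setT 4; last first.
  have := vol_deg_le (d := 3) degs; rewrite cardsT cT => le_vol.
  exact: leq_trans le_vol _.
have [leC|gtC] := leqP #|C| 8.
  by case: (@no_small_closed 3 i C) => //; rewrite C4.
have := conn_vol (m := 3) (n0 := 7) (B := 24) (E_sym i) (E_irr i) _ _ cnC.
have leC6 : paths_le (E i) C 6 := paths_le_subset (subsetT C) (leE i).
move=> /(_ isT (fun A cn le => vol_conn7 (E_sym i) (E_irr i) cn le) leC6).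
move=> /(_ (ltnW (ltnW gtC))); rewrite (vol_closed (E_sym i) clC).
have := vol_le_card (E_irr i) (setT :\: C); rewrite setTD.
have := cardsC C; rewrite cT => cC.
have -> : #|~: C| = 13 - #|C| by rewrite -cC addKn.
have leC13 : #|C| <= 13 by rewrite -cC leq_addr.
(* The bound 24 + 4(c - 7) + (13 - c)(12 - c) is at most 48 for c from 9 to 13, below the 52
   required. *)
by move: #|C| gtC leC13 => c; clear; do 14?[case: c => [|c] //]; lia.
Qed.

(** The value 86 = 56 + 30 is that of disjoint complete graphs on 8 and 6 vertices. *)
Lemma vol14_le i S : #|S| = 14 -> paths_le (E i) S 8 -> vol (E i) S <= 86.
Proof.
move=> cS leS.
have [[C [clC cnC C7]]|degs] :=
  big_component_or_deg (E_sym i) (E_irr i) S 7; last first.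
  by have := vol_deg_le (d := 6) degs; rewrite cS => /leq_trans->.
have [sCS _] := closed_inP _ _ _ clC; have leC8 := paths_le_subset sCS leS.
have cC := cardsD S C; rewrite (setIidPr sCS) cS in cC.
have leC14 : #|C| <= 14 by rewrite -cS subset_leq_card.
have := vol_le_card (E_irr i) (S :\: C); rewrite cC (vol_closed (E_sym i) clC).
have [c8|gtC] : #|C| = 8 \/ 9 <= #|C| by move: C7; clear; lia.
  by have := vol_le_card (E_irr i) C; rewrite c8; clear; lia.
have := conn_vol (m := 4) (n0 := 9) (B := 46) (E_sym i) (E_irr i) _ _ cnC.
move=> /(_ isT (fun A cn le => vol_conn9 (E_sym i) (E_irr i) cn le) leC8 gtC).
by move: #|C| gtC leC14 => c; clear; do 15?[case: c => [|c] //]; lia.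
Qed.

Lemma long_path17 : #|T| = 17 -> (forall i, paths_le (E i) setT 8) -> False.
Proof.
move=> cT leE; have [i gt_i] : exists i, 90 < vol (E i) setT.
  by apply: pigeonhole3; rewrite (sum_vol E_irr E_sum) cardsT cT.
have [[C [clC cnC C6]]|degs] :=
  big_component_or_deg (E_sym i) (E_irr i) setT 6; last first.
  have := vol_deg_le (d := 5) degs; rewrite cardsT cT leqNgt => /negP[].
  exact: leq_trans gt_i.
have [leC|gtC] := leqP #|C| 10.
  by case: (@no_small_closed 4 i C) => //; rewrite C6.
have leC8 : paths_le (E i) C 8 := paths_le_subset (subsetT C) (leE i).
have CT : C = setT.
  apply/eqP; rewrite eqEcard subsetT cardsT cT leqNgt; apply/negP=> ltC.
  have := conn_vol (m := 4) (n0 := 9) (B := 46) (E_sym i) (E_irr i) _ _ cnC.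
  move=> /(_ isT (fun A cn le => vol_conn9 (E_sym i) (E_irr i) cn le) leC8).
  move=> /(_ (ltnW (ltnW gtC))); apply/negP; rewrite -ltnNge.
  move: gt_i; rewrite (vol_closed (E_sym i) clC) setTD.
  have := vol_le_card (E_irr i) (~: C); have := cardsC C; rewrite cT => cC.
  have -> : #|~: C| = 17 - #|C| by rewrite -cC addKn.
  by move: #|C| gtC ltC => c; clear; do 18?[case: c => [|c] //]; lia.
(* 92 = 6 * 17 - 10 is the threshold of [dense_conn_core3]; parity excludes 91. *)
rewrite CT in cnC; have vol92 : 6 * #|[set: T]| <= vol (E i) setT + 10.
  rewrite cardsT cT; have := vol_even (E_sym i) (E_irr i) setT.
  by move: (vol _ _) gt_i => v; clear; have [->//|] := eqVneq v 91; lia.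
have cT10 : 10 <= #|[set: T]| by rewrite cardsT cT.
have [K [D c3]] := dense_conn_core3 (E_sym i) (E_irr i) cnC (leE i) cT10 vol92.
have le2 := core3_vol_out (E_irr i) c3; rewrite setTD in le2.
have cW : #|~: K| = 14.
  by case: c3 => _ _ cK _ _; have := cardsC K; rewrite cT cK => /addnI.
have := sum_vol E_irr E_sum (~: K); rewrite (bigD1 i) //= cW => sumE.
have le_sum : \sum_(j < 3 | j != i) vol (E j) (~: K) <= 2 * 86.
  have c2 : #|[pred j | j != i]| = 2 by rewrite (cardC1 i) card_ord.
  rewrite -[X in X * _]c2 -sum_nat_const; apply: leq_sum => j _.
  by apply: vol14_le => //; apply: paths_le_subset (subsetT _) (leE j).
(* 14 * 13 = 182 exceeds 2 + 2 * 86 = 174. *)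
by have := leq_trans (eq_leq (esym sumE)) (leq_add le2 le_sum).
Qed.

End UpperBounds.

(** * From colour classes to Ramsey numbers, and the lower bounds *)

Lemma colour_adj_sum N (c : edge_colouring (complete_graph N) 3) x y :
  x != y -> \sum_(i < 3) colour_adj c i x y = 1.
Proof.
move=> xy; rewrite (bigD1 (c [set x; y])) //= big1 => [|i ic].
  by rewrite /colour_adj /adj /= /complete_adj xy eqxx.
by rewrite /colour_adj eq_sym (negbTE ic) andbF.
Qed.

Lemma ipath_copy (H : sgraph) L p : 0 < L ->
  ipath (@adj H) setT p -> L <= size p -> contains_copy H (path_graph L).
Proof.
case: p => [|x0 p]; first by move=> L0 _; rewrite leqNgt L0.
move=> _ /and3P[up /pathP sp _] le_L; exists (fun k : 'I_L => nth x0 (x0 :: p) k).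
  move=> i j /eqP; rewrite nth_uniq ?(leq_trans (ltn_ord _)) // => /eqP.
  exact: val_inj.
have step (i j : 'I_L) : i.+1 = j -> adj (nth x0 (x0 :: p) i) (nth x0 (x0 :: p) j).
  by move=> ij; rewrite -ij; apply: sp; have := leq_trans (ltn_ord j) le_L; rewrite -ij.
by move=> i j /orP[]/eqP/step //; rewrite adj_sym.
Qed.

Lemma ramsey3_of_paths N L : 0 < L ->
    (forall (T : finType) (E : 'I_3 -> rel T), (forall i, symmetric (E i)) ->
       (forall i, irreflexive (E i)) ->
       (forall x y, x != y -> \sum_(i < 3) E i x y = 1) -> #|T| = N ->
       (forall i, paths_le (E i) setT L.-1) -> False) ->
  ramsey3_prop (path_graph L) N.
Proof.
move=> L0 noE c; pose E i := @colour_adj (complete_graph N) 3 c i : rel 'I_N.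
have [/existsP[i /existsP[p ip]]|/existsPn none] :=
  boolP [exists i, [exists p : L.-tuple 'I_N, ipath (E i) setT p]].
  exists i; apply: (@ipath_copy (colour_class c i) L p) => //.
  by rewrite size_tuple.
case: (noE 'I_N E (colour_adj_sym c) (colour_adj_irrefl c) (colour_adj_sum c)).
  exact: card_ord.
move=> i p /and3P[up sp _]; rewrite -ltnS prednK // ltnNge; apply/negP=> le_p.
have /existsP[] := none i; have sz : size (take L p) = L by apply: size_takel.
exists (tcast sz (in_tuple (take L p))); rewrite val_tcast /=.
apply/and3P; split; [exact: take_uniq | | by apply/allP=> x; rewrite inE].
by move: sp; rewrite -{1}(cat_take_drop L p); case: (take L p) => //= a s;
  rewrite cat_path => /andP[].
Qed.

(* The three nonzero linear forms on the residue mod 4, read as a vector of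
   F_2^2; two distinct residues agree on exactly one of them. *)
Definition residue_form (i : 'I_3) (x : nat) : bool :=
  match val i with
  | 0 => odd x
  | 1 => odd x./2
  | _ => odd x (+) odd x./2
  end.

(** An edge receives the first form that agrees at its two ends. Constancy on the set avoids
    ordering the ends; if forms 0 and 1 both differ, form 2, their sum, agrees. *)
Definition residue_colouring N : edge_colouring (complete_graph N) 3 :=
  fun A : {set 'I_N} =>
    let constant i :=
      [forall x in A, forall y in A, residue_form i x == residue_form i y] in
    if constant (inord 0) then inord 0
    else if constant (inord 1) then inord 1 else inord 2.

Lemma residue_colouringP N (i : 'I_3) (x y : 'I_N) :
  residue_colouring [set x; y] = i -> residue_form i x = residue_form i y.
Proof.
have pair (P : rel 'I_N) : (forall z, P z z) ->
    P x y -> P y x -> [forall u in [set x; y], forall v in [set x; y], P u v].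
  move=> Pr Pxy Pyx; apply/forall_inP=> u; rewrite !inE => ux.
  apply/forall_inP=> v; rewrite !inE => vx.
  by case/orP: ux => /eqP->; case/orP: vx => /eqP->.
have unpair (P : rel 'I_N) :
    [forall u in [set x; y], forall v in [set x; y], P u v] -> P x y.
  by move/forall_inP/(_ x (set21 x y))/forall_inP/(_ y (set22 x y)).
rewrite /residue_colouring; case: ifP => [/unpair/eqP eq0 <- //|ne0].
case: ifP => [/unpair/eqP eq1 <- //|ne1] <-.
have {ne0} : residue_form (inord 0) x != residue_form (inord 0) y.
  by apply: contraFneq ne0 => eq0; apply: pair => //=; rewrite ?eq0.
have {ne1} : residue_form (inord 1) x != residue_form (inord 1) y.
  by apply: contraFneq ne1 => eq1; apply: pair => //=; rewrite ?eq1.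
rewrite /residue_form /= !inordK //.
by case: (odd x) (odd x./2) (odd y) (odd y./2) => [] [] [] [].
Qed.

(** Each form takes each value twice on every block of four consecutive numbers. *)
Lemma card_residue_form m (i : 'I_3) b :
  count (fun x => residue_form i x == b) (iota 0 (4 * m)) = 2 * m.
Proof.
have per n x : residue_form i (4 * n + x) = residue_form i x.
  have odd4 : odd (4 * n + x) = odd x by rewrite oddD oddM.
  have half4 : odd (4 * n + x)./2 = odd x./2.
    by rewrite -[4 * n]/(2 * 2 * n) -mulnA mul2n halfD odd_double doubleK add0n oddD oddM.
  by rewrite /residue_form odd4 half4.
elim: m => [|m IHm] //; rewrite mulnS addnC iotaD count_cat IHm add0n mulnS [RHS]addnC.
congr (_ + _); rewrite -[4 * m]addn0 iotaDl count_map.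
rewrite (eq_count (a2 := fun x => residue_form i x == b)) => [|x /=]; last by rewrite per.
by case: i b {per IHm} => -[|[|[|//]]] lti [].
Qed.

(** Form [i] is constant along a path of colour [i], whose 2m + 1 vertices cannot fit into a class
    of at most 2m. The colouring is used on any [M] up to 4m, so monotonicity in the number of
    vertices need not be proved. *)
Lemma ramsey3_path_lower m M : ramsey3_prop (path_graph m.*2.+1) M -> (4 * m).+1 <= M.
Proof.
move=> ram; rewrite ltnNge; apply/negP=> leM.
have [i [f f_inj f_adj]] := ram (@residue_colouring M).
pose b := residue_form i (f ord0).
have fb k (ltk : k < m.*2.+1) : residue_form i (f (Ordinal ltk)) = b.
  elim: k ltk => [|k IHk] ltk; first by congr (residue_form i (f _)); apply: val_inj.
  rewrite -(IHk (ltnW ltk)); apply/esym.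
  have /f_adj/andP[_ /eqP] : @path_adj m.*2.+1 (Ordinal (ltnW ltk)) (Ordinal ltk).
    by rewrite /path_adj /= eqxx.
  exact: residue_colouringP.
have : #|[set f x | x in 'I_m.*2.+1]| <= #|[set x : 'I_M | residue_form i x == b]|.
  apply/subset_leq_card/subsetP=> _ /imsetP[[k ltk] _ ->].
  by rewrite inE fb.
rewrite card_imset // card_ord leqNgt => /negP[].
rewrite ltnS -muln2 mulnC -(card_residue_form m i b) -(subnKC leM) iotaD count_cat.
apply: leq_trans (leq_addr _ _); rewrite cardsE cardE /enum_mem size_filter.
rewrite -(count_map (fun x : 'I_M => x : nat) (fun x => residue_form i x == b)).
by rewrite -enumT /= val_enum_ord.
Qed.

Theorem corollary7 :
  is_ramsey3 (path_graph 7) 13 /\ is_ramsey3 (path_graph 9) 17.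
Proof.
split; split.
- by apply: ramsey3_of_paths => // T E sy ir su cT le; apply: (@long_path13 T E).
- exact: (@ramsey3_path_lower 3).
- by apply: ramsey3_of_paths => // T E sy ir su cT le; apply: (@long_path17 T E).
exact: (@ramsey3_path_lower 4).
Qed.
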